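(* Let $0\le\mu<L<\infty$, let $K\ge1$ be an integer, and let $\mathcal{A}$ be a fixed-step first-order method with step sizes $\{\eta_k^i\}$ such that $\eta_k^k\ne0$ for $k=0,\dots,K-1$. Let $\mathcal{Z}=\mathcal{F}\cap\mathcal{X}\subset\mathbf{S}_+^{K+2}\times\mathbf{R}^{K+1}$ be the lifted set for the class $\mathcal{F}_{\mu,L}$ of $L$-smooth $\mu$-strongly convex functions and the initial condition (see context), described by $(A_m,b_m)_{m\in M}$ and $(A_0,b_0,c_0)$. Let $(\hat G_1,\hat F_1),\dots,(\hat G_N,\hat F_N)\in\mathcal{Z}$ be samples drawn from $\mathbf{P}_Z$, and let $\mathcal{B}_\varepsilon$ be the $1$-Wasserstein ball of radius $\varepsilon$ around the empirical distribution (see context). Given $A_{\rm obj}^j\in\mathbf{S}^{K+2}$, $b_{\rm obj}^j\in\mathbf{R}^{K+1}$, $c_{\rm obj}^j\in\mathbf{R}$ for $j=1,\dots,J$, let $$\mathcal{L}=\Big\{(G,F)\mapsto\max_{1\le j\le J}\big(\langle(A_{\rm obj}^j,b_{\rm obj}^j),(G,F)\rangle+c_{\rm obj}^j\,t\big)\ \Big|\ t\in\mathbf{R}\Big\}.$$ Then for every $\varepsilon>0$ the quantity $$\sup_{\mathbf{Q}_Z\in\mathcal{B}_\varepsilon}\ \inf_{\ell\in\mathcal{L}}\ \mathbf{E}_{(G,F)\sim\mathbf{Q}_Z}\big(\ell(G,F)\big)$$ equals the optimal value of the problem $$\begin{array}{ll}\text{maximize}&\sum_{i=1}^N\sum_{j=1}^J\pi_i^j\,\langle(A_{\rm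 obj}^j,b_{\rm obj}^j),(G_i^j,F_i^j)\rangle\\ \text{subject to}&\sum_{i=1}^N\sum_{j=1}^J\pi_i^j\,\|(G_i^j,F_i^j)-(\hat G_i,\hat F_i)\|\le\varepsilon,\end{array}$$ with variables $(G_i^j,F_i^j)\in\mathcal{Z}$ and $(\pi_i^j)\in\Gamma$, where $$\Gamma=\Big\{(\pi_i^j)\in\mathbf{R}_+^{NJ}\ \Big|\ \sum_{j=1}^J\pi_i^j=\tfrac1N\ (i=1,\dots,N),\quad \sum_{j=1}^J\Big(\sum_{i=1}^N\pi_i^j\Big)c_{\rm obj}^j=0\Big\},$$ and it also equals the optimal value of the problem $$\begin{array}{ll}\text{minimize}&\frac1N\sum_{i=1}^Ns_i\\ \text{subject to}&c_{\rm obj}^jt-c_0\tau_i^j-\langle(X_i^j,Y_i^j),(\hat G_i,\hat F_i)\rangle+\lambda\varepsilon\le s_i,\\ &\sum_{m\in M}(y_i^j)_m(A_m,b_m)-(X_i^j,Y_i^j)+\tau_i^j(A_0,b_0)-(A_{\rm obj}^j,b_{\rm obj}^j)\in\mathbf{S}_+^{K+2}\times\{0\},\\ &\|(X_i^j,Y_i^j)\|_*\le\lambda,\qquad i=1,\dots,N,\ j=1,\dots,J,\end{array}$$ with variables $s_i\in\mathbf{R}$, $t\in\mathbf{R}$, $\tau_i^j\in\mathbf{R}_+$, $(X_i^j,Y_i^j)\in\mathbf{S}^{K+2}\times\mathbf{R}^{K+1}$, $\lambda\in\mathbf{R}_+$, and $y_i^j\in\mathbf{R}_+^{|M|}$.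
   Context: Notation: $\mathbf{S}^n$ ($\mathbf{S}^n_+$) is the space of symmetric (positive semidefinite) $n\times n$ matrices. On $\mathbf{S}^{K+2}\times\mathbf{R}^{K+1}$, $\langle(X,Y),(G,F)\rangle=\mathrm{tr}(X^TG)+Y^TF$ and $\|(G,F)\|=\sqrt{\|G\|_F^2+\|F\|_2^2}$ ($\|\cdot\|_F$ Frobenius); its dual norm $\|\cdot\|_*$ is the same norm. Fixed-step first-order method: $x^{k+1}=x^k-\sum_{i=0}^k\eta_k^i g^i$, $g^i=\nabla f(x^i)$, with scalars $\eta_k^i$ fixed independently of the instance $(f,x^0)$. Instances: pairs $(f,x^0)$ with $f:\mathbf{R}^d\to\mathbf{R}$ in $\mathcal{F}_{\mu,L}$ (differentiable, $L$-Lipschitz gradient, $\mu$-strongly convex; convex if $\mu=0$), normalized so that $x^\star=0$ is a minimizer and $f^\star=f(x^\star)=0$, and with $\|x^0-x^\star\|^2\le r^2$ ($r>0$ fixed). The large-scale regime $d\ge K+2$ is assumed. Lifting: with $f^k=f(x^k)$, $P=[\,x^0-x^\star\ \ g^0\ \cdots\ g^K\,]\in\mathbf{R}^{d\times(K+2)}$, the lift of $(f,x^0)$ is $Z=(G,F)$ with $G=P^TP\in\mathbf{S}_+^{K+2}$ and $F=(f^0-f^\star,\dots,f^K-f^\star)\in\mathbf{R}^{K+1}$. Lifted set: let $\mathcal{I}=\{\star,0,\dots,K\}$ and $M=\{(p,q)\in\mathcal{I}\times\mathcal{I}: p\ne q\}$. The interpolation conditions of $\mathcal{F}_{\mu,L}$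 are, for all $(p,q)\in M$, $$f^p\ge f^q+\langle g^q,x^p-x^q\rangle+\tfrac{1}{2(1-\mu/L)}\Big(\tfrac1L\|g^p-g^q\|^2+\mu\|x^p-x^q\|^2-\tfrac{2\mu}{L}\langle g^q-g^p,x^q-x^p\rangle\Big),$$ where $x^\star=g^\star=0$, $f^\star=0$ and $x^k=x^0-\sum_{l<k}\sum_{i\le l}\eta_l^ig^i$. Since each $x^k,g^k$ is a fixed linear combination of the columns of $P$, each condition can be written as $\langle(A_m,b_m),(G,F)\rangle\le0$ with $A_m\in\mathbf{S}^{K+2}$, $b_m\in\mathbf{R}^{K+1}$, $m=(p,q)$. The initial condition $\|x^0-x^\star\|^2\le r^2$ is written as $\langle(A_0,b_0),(G,F)\rangle+c_0\le0$ (i.e. $A_0=e_1e_1^T$, $b_0=0$, $c_0=-r^2$). Then $$\mathcal{Z}=\mathcal{F}\cap\mathcal{X}=\{(G,F)\in\mathbf{S}_+^{K+2}\times\mathbf{R}^{K+1}:\langle(A_m,b_m),(G,F)\rangle\le0\ \forall m\in M,\ \langle(A_0,b_0),(G,F)\rangle+c_0\le0\}.$$ Distributions: $\mathbf{P}_Z$ is a probability distribution on $\mathcal{Z}$, the pushforward under lifting of a distribution $\mathbf{P}$ of instances $(f,x^0)$. $\hat{\mathbf{P}}_Z=\frac1N\sum_{i=1}^N\delta_{(\hat G_i,\hat F_i)}$. With $W$ the $1$-Wasserstein distance on probability measures on $\mathcal{Z}$ with ground cost $\|Z_1-Z_2\|$, $\mathcal{B}_\varepsilon=\{\mathbf{Q}_Z$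 probability measure on $\mathcal{Z}: W(\hat{\mathbf{P}}_Z,\mathbf{Q}_Z)\le\varepsilon\}$. *)

(* Defs.v *)
From HB Require Import structures.
From mathcomp Require Import all_boot all_order all_algebra.
From mathcomp Require Import all_classical all_reals all_analysis.
From mathcomp Require Import ring lra.

Set Implicit Arguments.
Unset Strict Implicit.
Unset Printing Implicit Defensive.

Import Order.TTheory GRing.Theory Num.Theory.
Import numFieldNormedType.Exports.

Local Open Scope classical_set_scope.
Local Open Scope ring_scope.

(* The ambient space R^{n x n} x R^k of the pairs (G, F).  Symmetry of the first
   component is imposed where it is needed (lifted set, dual variables, problem
   data), and the product topology is the one of the norm [gf_norm] below. *)
Definition gf (R : realType) (n k : nat) : Type := ('M[R]_n.+1 * 'cV[R]_k.+1)%type.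

Section Geometry.
Context {R : realType} {n k : nat}.
Implicit Types (z w : gf R n k) (A : 'M[R]_n.+1).

Definition sym_mx A : Prop := A^T = A.

Definition psd A : Prop :=
  sym_mx A /\ forall v : 'cV[R]_n.+1, 0 <= (v^T *m A *m v) 0 0.

Definition gf_ip z w : R := \tr (z.1^T *m w.1) + (z.2^T *m w.2) 0 0.

Definition frobenius A : R := Num.sqrt (\sum_i \sum_j A i j ^+ 2).

Definition euclidean m (v : 'cV[R]_m) : R := Num.sqrt (\sum_i v i 0 ^+ 2).

Definition gf_norm z : R :=
  Num.sqrt (frobenius z.1 ^+ 2 + euclidean z.2 ^+ 2).

Definition gf_dual_norm z : R :=
  sup [set gf_ip z w | w in [set w | sym_mx w.1 /\ gf_norm w <= 1]].

End Geometry.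

(* The fixed-step method x_{l+1} = x_l - \sum_{i <= l} eta l i *: g_i, in any
   module: applied to vectors it gives the iterates, applied to the unit vectors
   below it gives the coordinates of the iterates in the columns of
   P = [x0 | g0 | ... | gK]. *)
Fixpoint iterate (R : realType) (V : lmodType R) (eta : nat -> nat -> R)
    (x0 : V) (g : nat -> V) (l : nat) : V :=
  if l is l'.+1 then
    iterate eta x0 g l' - \sum_(i < l'.+1) eta l' i *: g i
  else x0.

(* {star, 0, ..., K}, with None for star, and the ordered pairs of distinct
   elements. *)
Definition interp_index (K : nat) := option 'I_K.+1.
Definition index_pair (K : nat) := {m : interp_index K * interp_index K | m.1 != m.2}.

Section LiftedSet.
Context {R : realType}.

Definition unit_col m (i : nat) : 'cV[R]_m := \col_j ((j : nat) == i)%:R.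

Variables (K : nat) (eta : nat -> nat -> R) (mu L r : R).

(* Coordinates of x^p and g^p in the columns of P (see [iterate]), and of
   f^p in F; all of them vanish at star. *)
Definition x_coord (p : interp_index K) : 'cV[R]_K.+2 :=
  if p is Some l then
    iterate eta (unit_col K.+2 0) (fun i => unit_col K.+2 i.+1) l
  else 0.

Definition g_coord (p : interp_index K) : 'cV[R]_K.+2 :=
  if p is Some l then unit_col K.+2 l.+1 else 0.

Definition f_coord (p : interp_index K) : 'cV[R]_K.+1 :=
  if p is Some l then unit_col K.+1 l else 0.

(* The symmetric matrix representing G |-> u^T G v on symmetric matrices. *)
Definition sym_outer m (u v : 'cV[R]_m) : 'M[R]_m :=
  2^-1 *: (u *m v^T + v *m u^T).

(* (A_m, b_m) for m = (p, q): the interpolation inequality written as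
   right-hand side - left-hand side <= 0; see [gf_ip_interp_data]. *)
Definition interp_data (m : index_pair K) : gf R K.+1 K :=
  let: (p, q) := val m in
  (sym_outer (g_coord q) (x_coord p - x_coord q) +
   (2 * (1 - mu / L))^-1 *:
     (L^-1 *: sym_outer (g_coord p - g_coord q) (g_coord p - g_coord q)
      + mu *: sym_outer (x_coord p - x_coord q) (x_coord p - x_coord q)
      - (2 * mu / L) *:
          sym_outer (g_coord q - g_coord p) (x_coord q - x_coord p)),
   f_coord q - f_coord p).

(* (A_0, b_0) and c_0; see [gf_ip_init_data]. *)
Definition init_data : gf R K.+1 K := (delta_mx 0 0, 0).
Definition init_const : R := - r ^+ 2.

Definition lifted_set : set (gf R K.+1 K) :=
  [set z | [/\ psd z.1,
               forall m, gf_ip (interp_data m) z <= 0 &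
               gf_ip init_data z + init_const <= 0]].

End LiftedSet.

Section Lift.
Context {R : realType} (d K : nat).
Variables (eta : nat -> nat -> R) (x0 : 'cV[R]_d) (g : nat -> 'cV[R]_d)
          (f : nat -> R).

Definition dot (u v : 'cV[R]_d) : R := (u^T *m v) 0 0.

Definition lift_mx : 'M[R]_(d, K.+2) :=
  \matrix_(i, j) (if (j : nat) is j'.+1 then g j' i 0 else x0 i 0).

Definition lift_gf : gf R K.+1 K := (lift_mx^T *m lift_mx, \col_j f j).

Definition x_at (p : interp_index K) : 'cV[R]_d :=
  if p is Some l then iterate eta x0 g l else 0.
Definition g_at (p : interp_index K) : 'cV[R]_d := if p is Some l then g l else 0.
Definition f_at (p : interp_index K) : R := if p is Some l then f l else 0.

Lemma lift_mx_unit_col i : (i < K.+2)%N ->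
  lift_mx *m unit_col K.+2 i = if i is i'.+1 then g i' else x0.
Proof.
move=> iK; apply/colP => a; rewrite !mxE.
rewrite (bigD1 (Ordinal iK)) //= big1 => [|j jN].
  by rewrite !mxE /= eqxx mulr1 addr0; case: i {iK}.
by rewrite !mxE -[(j : nat) == i]/(j == Ordinal iK) (negbTE jN) mulr0.
Qed.

Lemma lift_mx_x_coord p : lift_mx *m x_coord eta p = x_at p.
Proof.
case: p => [[l lK]|] /=; last by rewrite mulmx0.
elim: l lK => [|l IH] lK /=; first by rewrite lift_mx_unit_col.
rewrite mulmxBr IH 1?ltnW // mulmx_sumr; congr (_ - _).
apply: eq_bigr => i _; rewrite -scalemxAr lift_mx_unit_col //.
by rewrite ltnS (leq_trans (ltn_ord i)) // ltnW.
Qed.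

Lemma lift_mx_g_coord p : lift_mx *m @g_coord R K p = g_at p.
Proof.
case: p => [l|] /=; last by rewrite mulmx0.
by rewrite lift_mx_unit_col // ltnS ltn_ord.
Qed.

Lemma f_coord_dot (p : interp_index K) :
  ((@f_coord R K p)^T *m (\col_(j < K.+1) f j)) 0 0 = f_at p.
Proof.
case: p => [l|] /=; last by rewrite trmx0 mul0mx mxE.
rewrite mxE (bigD1 l) //= big1 => [|j jN].
  by rewrite !mxE eqxx mul1r addr0.
by rewrite !mxE -[(j : nat) == l]/(j == l) (negbTE jN) mul0r.
Qed.

Lemma dotC u v : dot u v = dot v u.
Proof. by rewrite /dot -[in RHS](trmxK u) -trmx_mul [in RHS]mxE. Qed.

Lemma tr_sym_outer (u v : 'cV[R]_K.+2) :
  \tr ((sym_outer u v)^T *m (lift_mx^T *m lift_mx))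
  = dot (lift_mx *m u) (lift_mx *m v).
Proof.
have tr_outer (a b : 'cV[R]_K.+2) :
    \tr (a *m b^T *m (lift_mx^T *m lift_mx)) = dot (lift_mx *m b) (lift_mx *m a).
  by rewrite -mulmxA mxtrace_mulC /dot trmx_mul !mulmxA /mxtrace big_ord1.
rewrite /sym_outer !linearZ linearD /= !trmx_mul !trmxK -scalemxAl mxtraceZ.
rewrite mulmxDl mxtraceD !tr_outer [dot (_ *m v) _]dotC.
by field.
Qed.

Lemma gf_ip_interp_data (mu L : R) (m : index_pair K) :
  let: (p, q) := val m in
  gf_ip (interp_data eta mu L m) lift_gf =
  f_at q + dot (g_at q) (x_at p - x_at q)
  + (2 * (1 - mu / L))^-1 *
    (L^-1 * dot (g_at p - g_at q) (g_at p - g_at q)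
     + mu * dot (x_at p - x_at q) (x_at p - x_at q)
     - 2 * mu / L * dot (g_at q - g_at p) (x_at q - x_at p))
  - f_at p.
Proof.
case mE: (val m) => [p q]; rewrite /gf_ip /interp_data mE /lift_gf /=.
have -> : ((@f_coord R K q - @f_coord R K p)^T *m (\col_(j < K.+1) f j)) 0 0
          = f_at q - f_at p.
  by rewrite linearB /= mulmxBl mxE f_coord_dot mxE f_coord_dot.
pose q_ (A : 'M[R]_K.+2) := \tr (A^T *m (lift_mx^T *m lift_mx)).
have qD A B : q_ (A + B) = q_ A + q_ B.
  by rewrite /q_ linearD /= mulmxDl mxtraceD.
have qZ a A : q_ (a *: A) = a * q_ A.
  by rewrite /q_ linearZ /= -scalemxAl mxtraceZ.
have qN A : q_ (- A) = - q_ A by rewrite -scaleN1r qZ mulN1r.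
have qS u v : q_ (sym_outer u v) = dot (lift_mx *m u) (lift_mx *m v).
  exact: tr_sym_outer.
rewrite -/(q_ _) !(qS, qD, qZ, qN).
rewrite !mulmxBr !lift_mx_x_coord !lift_mx_g_coord.
by ring.
Qed.

Lemma gf_ip_init_data (r : R) :
  gf_ip (init_data K) lift_gf + init_const r = dot x0 x0 - r ^+ 2.
Proof.
rewrite /gf_ip /init_data /init_const /= trmx0 mul0mx [X in _ + X - _]mxE addr0.
congr (_ - _).
have -> : delta_mx 0 0 = sym_outer (unit_col K.+2 0) (unit_col K.+2 0) :> 'M[R]_K.+2.
  apply/matrixP => i j; rewrite !mxE big_ord1 !mxE /=.
  rewrite -![(_ : nat) == 0%N]/(_ == ord0) -!natrM mulnb.
  by rewrite andbC; case: (_ && _) => /=; lra.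
by rewrite tr_sym_outer lift_mx_unit_col.
Qed.

End Lift.

Section DualNorm.
Context {R : realType} {n k : nat}.
Implicit Types z w : gf R n k.

Lemma gf_ipE z w : gf_ip z w =
  \sum_i \sum_j z.1 i j * w.1 i j + \sum_i z.2 i 0 * w.2 i 0.
Proof.
rewrite /gf_ip /mxtrace; congr (_ + _).
  rewrite exchange_big; apply: eq_bigr => i _; rewrite mxE.
  by apply: eq_bigr => j _; rewrite mxE.
by rewrite mxE; apply: eq_bigr => j _; rewrite mxE.
Qed.

Lemma gf_ip_ge0 z : 0 <= gf_ip z z.
Proof.
rewrite gf_ipE addr_ge0 ?sumr_ge0 // => i _; rewrite ?sumr_ge0 // => *;
  by rewrite -expr2 sqr_ge0.
Qed.

Lemma gf_normE z : gf_norm z = Num.sqrt (gf_ip z z).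
Proof.
rewrite /gf_norm /frobenius /euclidean !sqr_sqrtr ?gf_ipE //.
- by rewrite sumr_ge0 // => i _; rewrite sqr_ge0.
- by rewrite sumr_ge0 // => i _; rewrite sumr_ge0 // => j _; rewrite sqr_ge0.
Qed.

Lemma gf_norm_ge0 z : 0 <= gf_norm z. Proof. exact: sqrtr_ge0. Qed.

Lemma gf_norm_sqr z : gf_norm z ^+ 2 = gf_ip z z.
Proof. by rewrite gf_normE sqr_sqrtr // gf_ip_ge0. Qed.

Lemma gf_ipC z w : gf_ip z w = gf_ip w z.
Proof.
rewrite !gf_ipE; congr (_ + _); last by apply: eq_bigr => i _; rewrite mulrC.
by apply: eq_bigr => i _; apply: eq_bigr => j _; rewrite mulrC.
Qed.

Lemma gf_ipBl z w u (a : R) :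
  gf_ip (a *: z.1 - w.1, a *: z.2 - w.2) u = a * gf_ip z u - gf_ip w u.
Proof.
rewrite !gf_ipE /= mulrDr opprD addrACA !mulr_sumr -!sumrB.
congr (_ + _); apply: eq_bigr => i _; last by rewrite !mxE; ring.
by rewrite mulr_sumr -sumrB; apply: eq_bigr => j _; rewrite !mxE; ring.
Qed.

Lemma gf_ipDZ z w (a : R) :
  gf_ip (a *: z.1 - w.1, a *: z.2 - w.2) (a *: z.1 - w.1, a *: z.2 - w.2) =
  a ^+ 2 * gf_ip z z - 2 * a * gf_ip z w + gf_ip w w.
Proof.
rewrite gf_ipBl [gf_ip z _]gf_ipC [gf_ip w (_, _)]gf_ipC !gf_ipBl [gf_ip w z]gf_ipC.
by ring.
Qed.

Lemma gf_cauchy_schwarz z w : gf_ip z w <= gf_norm z * gf_norm w.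
Proof.
have [z0|z0] := eqVneq (gf_ip z z) 0.
  have h a := gf_ip_ge0 (a *: z.1 - w.1, a *: z.2 - w.2).
  rewrite gf_normE z0 sqrtr0 mul0r leNgt; apply/negP => zw.
  have := h ((gf_ip w w + 1) / (2 * gf_ip z w)); rewrite gf_ipDZ z0 mulr0 add0r.
  have -> : 2 * ((gf_ip w w + 1) / (2 * gf_ip z w)) * gf_ip z w = gf_ip w w + 1.
    by field; exact: lt0r_neq0.
  by lra.
have zz : 0 < gf_ip z z by rewrite lt0r z0 gf_ip_ge0.
apply: le_trans (ler_norm _) _.
rewrite -(@ler_pXn2r _ 2) ?nnegrE ?mulr_ge0 ?gf_norm_ge0 //.
rewrite real_normK ?num_real // exprMn !gf_norm_sqr.
have := gf_ip_ge0 ((gf_ip z w / gf_ip z z) *: z.1 - w.1,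
                   (gf_ip z w / gf_ip z z) *: z.2 - w.2).
rewrite gf_ipDZ.
have -> : (gf_ip z w / gf_ip z z) ^+ 2 * gf_ip z z
    - 2 * (gf_ip z w / gf_ip z z) * gf_ip z w + gf_ip w w
    = gf_ip w w - gf_ip z w ^+ 2 / gf_ip z z by field.
by rewrite subr_ge0 ler_pdivrMr // mulrC.
Qed.

Lemma gf_dual_normE z : sym_mx z.1 -> gf_dual_norm z = gf_norm z.
Proof.
move=> zs; rewrite /gf_dual_norm; set S := (X in sup X).
have ubS : ubound S (gf_norm z).
  move=> _ [w [_ w1] <-]; apply: le_trans (gf_cauchy_schwarz _ _) _.
  by rewrite ler_piMr // gf_norm_ge0.
have ip0 : gf_ip z (0, 0) = 0 by rewrite /gf_ip /= !mulmx0 mxtrace0 mxE addr0.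
have S0 : S 0.
  exists (0, 0) => //; split; first by rewrite /sym_mx trmx0.
  rewrite gf_normE gf_ipE /= !big1 ?addr0 ?sqrtr0 ?ler01 // => i _.
    by rewrite mxE mul0r.
  by rewrite big1 // => j _; rewrite mxE mul0r.
have supS : has_sup S by split; [exists 0 | exists (gf_norm z)].
apply/eqP; rewrite eq_le; apply/andP; split.
  by apply: ge_sup => //; exists 0.
have [z0|z0] := eqVneq (gf_norm z) 0.
  by rewrite z0; apply: ub_le_sup => //; exists (gf_norm z).
have ipZ u : gf_ip u ((gf_norm z)^-1 *: z.1, (gf_norm z)^-1 *: z.2)
    = (gf_norm z)^-1 * gf_ip u z.
  by rewrite /gf_ip /= -!scalemxAr mxtraceZ [X in _ + X]mxE mulrDr.
apply: ub_le_sup; first by exists (gf_norm z).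
exists ((gf_norm z)^-1 *: z.1, (gf_norm z)^-1 *: z.2); last first.
  by rewrite ipZ -gf_norm_sqr expr2 mulKf.
split; first by rewrite /sym_mx /= linearZ /= zs.
rewrite gf_normE ipZ gf_ipC ipZ -gf_norm_sqr expr2 mulKf // mulVf //.
by rewrite sqrtr1.
Qed.

End DualNorm.

(* (G, F)-space with its Borel sigma-algebra.  A probability measure on a Borel
   subset Z is rendered as one on the whole space giving mass 1 to Z. *)
Definition gf_borel (R : realType) (n k : nat) :=
  g_sigma_algebraType (@open ('M[R]_n.+1 * 'cV[R]_k.+1)%type).

Section Ambiguity.
Context {R : realType} {n k : nat}.
Local Notation X := (gf_borel R n k).
Local Open Scope ereal_scope.

Definition empirical (N : nat) (zhat : 'I_N -> gf R n k) (A : set X) : \bar R :=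
  (N%:R^-1)%:E * \sum_(i < N) \d_(zhat i : X) A.

Definition coupling (P Q : set X -> \bar R)
    (g : probability (X * X)%type R) : Prop :=
  forall A : set X, measurable A ->
    g (A `*` setT) = P A /\ g (setT `*` A) = Q A.

Definition wasserstein (P Q : set X -> \bar R) : \bar R :=
  ereal_inf [set \int[g]_zw (gf_norm (zw.1 - zw.2 : gf R n k))%:E
            | g in coupling P Q].

Definition wasserstein_ball (Z : set (gf R n k)) (N : nat)
    (zhat : 'I_N -> gf R n k) (eps : R) : set (probability X R) :=
  [set Q : probability X R | Q (Z : set X) = 1 /\ wasserstein (empirical zhat) Q <= eps%:E].

(* For J > 0 the maximum is finite; -oo is only the neutral element. *)
Definition loss (J : nat) (obj : 'I_J -> gf R n k) (c : 'I_J -> R) (t : R)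
    (z : gf R n k) : \bar R :=
  \big[maxe/-oo]_(j < J) (gf_ip (obj j) z + c j * t)%:E.

Definition losses (J : nat) (obj : 'I_J -> gf R n k) (c : 'I_J -> R) :
    set (gf R n k -> \bar R) :=
  [set loss obj c t | t in [set: R]].

End Ambiguity.

Section Problems.
Context {R : realType}.
Variables (K : nat) (eta : nat -> nat -> R) (mu L r : R).
Variables (N J : nat) (zhat : 'I_N -> gf R K.+1 K).
Variables (obj : 'I_J -> gf R K.+1 K) (c : 'I_J -> R) (eps : R).

Definition Gamma : set ('I_N -> 'I_J -> R) :=
  [set w | [/\ forall i j, 0 <= w i j,
               forall i, \sum_(j < J) w i j = N%:R^-1 &
               \sum_(j < J) (\sum_(i < N) w i j) * c j = 0]].

Definition primal_feasible (z : 'I_N -> 'I_J -> gf R K.+1 K)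
    (w : 'I_N -> 'I_J -> R) : Prop :=
  [/\ forall i j, lifted_set eta mu L r (z i j),
      Gamma w &
      \sum_(i < N) \sum_(j < J) w i j * gf_norm (z i j - zhat i) <= eps].

Definition primal_objective (z : 'I_N -> 'I_J -> gf R K.+1 K)
    (w : 'I_N -> 'I_J -> R) : R :=
  \sum_(i < N) \sum_(j < J) w i j * gf_ip (obj j) (z i j).

Definition primal_value : \bar R :=
  ereal_sup [set v | exists z w,
    primal_feasible z w /\ v = (primal_objective z w)%:E].

(* The variable [xy i j] is the pair (X_i^j, Y_i^j). *)
Definition dual_feasible (s : 'I_N -> R) (t lam : R)
    (tau : 'I_N -> 'I_J -> R) (xy : 'I_N -> 'I_J -> gf R K.+1 K)
    (y : 'I_N -> 'I_J -> index_pair K -> R) : Prop :=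
  0 <= lam /\
  forall i j,
    [/\ 0 <= tau i j, forall m, 0 <= y i j m & sym_mx (xy i j).1] /\
    [/\ c j * t - init_const r * tau i j - gf_ip (xy i j) (zhat i) + lam * eps
          <= s i,
        psd (\sum_m y i j m *: (interp_data eta mu L m).1 - (xy i j).1
             + tau i j *: (init_data K).1 - (obj j).1),
        \sum_m y i j m *: (interp_data eta mu L m).2 - (xy i j).2
             + tau i j *: (init_data K).2 - (obj j).2 = 0 &
        gf_dual_norm (xy i j) <= lam].

Definition dual_value : \bar R :=
  ereal_inf [set v | exists s t lam tau xy y,
    dual_feasible s t lam tau xy y /\ v = (N%:R^-1 * \sum_(i < N) s i)%:E].

End Problems.

(* Main.v *)
From HB Require Import structures.
Require Import Defs.
From mathcomp Require Import all_boot all_order all_algebra.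
From mathcomp Require Import all_classical all_reals all_analysis.
From mathcomp Require Import ring lra.
From mathcomp Require Import measurable_realfun.

Set Implicit Arguments.
Unset Strict Implicit.
Unset Printing Implicit Defensive.

Import Order.TTheory GRing.Theory Num.Theory.
Import numFieldNormedType.Exports.

Local Open Scope classical_set_scope.
Local Open Scope ring_scope.

(** The value of the worst case is squeezed between the two finite-dimensional
problems, and these two have the same value by conic duality:
primal <= worst case <= dual <= primal.

A primal point (z, w) is a discrete distribution in disguise. The measure
putting mass [w i j] at [z i j] has total mass one, the measure putting the same
mass at [(zhat i, z i j)] couples it with the empirical one, and the cost of this
coupling is the left-hand side of the transport constraint. The expected loss is
at least the primal objective plus [t] times the pairing of the weights with [c],
which vanishes on [Gamma]; this is [primal_le_worst_case].

A dual point bounds the loss pointwise on the lifted set: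
[loss z <= s i + lam * (|z - zhat i| - eps)] for each sample [i], because positive
semidefinite matrices have nonnegative trace product ([psd_tr_ge0]) and because of
the inequality of Cauchy and Schwarz ([dual_pointwise]). Integrating this against a
nearly optimal coupling gives [worst_case_le_dual]. To integrate it without
disintegrating the coupling over the samples, the bound is rewritten as a function
of the first marginal, the minimum over [i] of [s i + lam * |z - zhat i|].

For the last inequality, the right-hand sides for which the dual constraints can be
met form a convex cone. If no dual point has cost at most [v], the cone misses the
corresponding point, and a separating functional, read off coordinate by
coordinate, consists of pairs [(z p, w p)] in the cone over the lifted set and of
a coefficient [q <= 0] of the cost; the pairs satisfy the primal constraints up to
the scaling factor [- q] ([dual_cone_polar]). When [q < 0], dividing by it gives a
primal point of value at least [v] ([dual_or_primal]). When [q = 0] all the weights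
vanish, and then so do the [z p], since the lifted set is bounded
([lifted_set_bounded]): this contradicts the functional being nonzero. The compactness of the primal problem thus takes the place of a strictly feasible
point, and the weak separation theorem for cones that need not be closed
([cone_separation]) suffices.

The lifted set is bounded because the interpolation inequalities between an
iterate and the minimizer give [|g_l| <= (L + mu) |x_l|] and
[0 <= f_l <= <g_l, x_l>], whereas [x_l] is a fixed combination of [x_0] and of the
gradients before [l]: starting from [|x_0| <= r], everything is bounded
inductively. *)


(** * Separation of a point from a convex cone *)

Definition convex_cone (R : realType) (V : lmodType R) (M : set V) : Prop :=
  [/\ M 0, forall u v, M u -> M v -> M (u + v) &
      forall (a : R) u, 0 <= a -> M u -> M (a *: u)].

(** By induction on the dimension: split off the first coordinate [a]. If the cone
does not reach both signs of [a], the half-space [a <= 0] or [0 <= a] contains it.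
Otherwise its slice [a = 0] is not everything, and a functional [d] that is
nonpositive on the slice extends by giving to [a] the slope
[sup {d w | (-1, w) in M}]: it is finite since the sum of a point of height [-1]
and a point of height [1] is in the slice. *)
Lemma cone_halfspace_rV (R : realType) n (M : set 'rV[R]_n) :
  convex_cone M -> (exists x, ~ M x) ->
  exists2 c : 'cV[R]_n, c != 0 & forall u, M u -> (u *m c) 0 0 <= 0.
Proof.
elim: n M => [|n IH] M [M0 MD MZ] [x Mx].
  by case: Mx; rewrite (_ : x = 0) //; apply/rowP => -[].
have split1 (u : 'rV[R]_n.+1) : u = row_mx (lsubmx (u : 'rV_(1 + n)))
    (rsubmx (u : 'rV_(1 + n))) by rewrite hsubmxK.
have splitM a (w : 'rV[R]_n) b (d : 'cV[R]_n) :
    ((row_mx a%:M w : 'rV_(1 + n)) *m (col_mx b%:M d : 'cV_(1 + n))) 0 0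
    = a * b + (w *m d) 0 0.
  by rewrite mul_row_col mxE -scalar_mxM !mxE eqxx mulr1n.
have splitE (u : 'rV[R]_n.+1) : exists a w, u = row_mx a%:M w :> 'rV_(1 + n).
  exists ((lsubmx (u : 'rV_(1 + n))) 0 0), (rsubmx (u : 'rV_(1 + n))).
  by rewrite -mx11_scalar -split1.
have splitZ t a (w : 'rV[R]_n) :
    t *: (row_mx a%:M w : 'rV_(1 + n)) = row_mx (t * a)%:M (t *: w).
  by rewrite scale_row_mx scale_scalar_mx.
have splitD a (w : 'rV[R]_n) a' w' :
    (row_mx a%:M w + row_mx a'%:M w' : 'rV_(1 + n)) = row_mx (a + a')%:M (w + w').
  by rewrite add_row_mx -raddfD.
have e0 (b : R) : b != 0 -> (col_mx b%:M 0 : 'cV[R]_(1 + n)) != 0.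
  move=> b0; apply/eqP => /(congr1 (fun A => usubmx A 0 0)).
  by rewrite col_mxKu !mxE eqxx mulr1n; exact/eqP.
have [[wp Mp]|noB] := pselect (exists w, M (row_mx 1%:M w : 'rV_(1 + n))); last first.
  exists (col_mx 1%:M 0 : 'cV_(1 + n)); first exact/e0/oner_neq0.
  move=> u; have [a [w ->]] := splitE u => Mu.
  rewrite splitM mulmx0 mxE addr0 mulr1 leNgt; apply/negP => a0; apply: noB.
  exists (a^-1 *: w); rewrite -[1](mulVf (lt0r_neq0 a0)) -splitZ.
  by apply: MZ => //; rewrite invr_ge0 ltW.
have [[wm Mm]|noA] := pselect (exists w, M (row_mx (-1)%:M w : 'rV_(1 + n))); last first.
  exists (col_mx (-1)%:M 0 : 'cV_(1 + n)).
    by apply: e0; rewrite oppr_eq0 oner_neq0.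
  move=> u; have [a [w ->]] := splitE u => Mu.
  rewrite splitM mulmx0 mxE addr0 mulrN1 oppr_le0 leNgt; apply/negP => a0; apply: noA.
  exists ((- a)^-1 *: w); rewrite (_ : -1 = (- a)^-1 * a).
    by rewrite -splitZ; apply: MZ => //; rewrite invr_ge0 oppr_ge0 ltW.
  by field; rewrite ltr0_neq0.
(* both signs of the first coordinate occur: extend a functional of the slice *)
pose M0' : set 'rV[R]_n := [set w | M (row_mx 0%:M w : 'rV_(1 + n))].
have cM0 : convex_cone M0'.
  split=> [|u v Mu Mv|a u a0 Mu]; rewrite /M0' /=.
  - by rewrite raddf0 row_mx0.
  - by rewrite -[0]addr0 -splitD; exact: MD.
  - by rewrite -[0](mulr0 a) -splitZ; exact: MZ.
have [|d d0 dM] := IH _ cM0.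
  apply: contrapT => /forallNP M0T; apply: Mx.
  have [a [w ->]] := splitE x.
  have M0T' u : M (row_mx 0%:M u : 'rV_(1 + n)) by exact: contrapT (M0T u).
  have [a0|a0] := leP 0 a.
    have := MD _ _ (MZ _ _ a0 Mp) (M0T' (w - a *: wp)).
    by rewrite splitZ splitD mulr1 addr0 addrC subrK.
  have a0' : 0 <= - a by rewrite oppr_ge0 ltW.
  have := MD _ _ (MZ _ _ a0' Mm) (M0T' (w + a *: wm)).
  by rewrite splitZ splitD mulrN1 opprK addr0 scaleNr addrC addrK.
pose A : set R := [set (w *m d) 0 0 | w in [set w | M (row_mx (-1)%:M w : 'rV_(1 + n))]].
have AB w w' : M (row_mx (-1)%:M w : 'rV_(1 + n)) -> M (row_mx 1%:M w' : 'rV_(1 + n)) ->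
    (w *m d) 0 0 <= - (w' *m d) 0 0.
  move=> Mw Mw'; rewrite -subr_le0 opprK.
  suff -> : (w *m d) 0 0 + (w' *m d) 0 0 = ((w + w') *m d) 0 0.
    by apply: dM; have := MD _ _ Mw Mw'; rewrite splitD addNr.
  by rewrite mulmxDl [RHS]mxE.
have supA : has_sup A.
  split; first by exists ((wm *m d) 0 0), wm.
  by exists (- (wp *m d) 0 0) => _ [w Mw <-]; exact: AB.
exists (col_mx (sup A)%:M d : 'cV_(1 + n)).
  apply/eqP => /(congr1 (@dsubmx R 1 n 1)); rewrite col_mxKd => d0'.
  by move/eqP: d0; apply; rewrite d0' raddf0.
move=> u; have [a [w ->]] := splitE u => Mu; rewrite splitM.
have [a0|a0|a0] := ltgtP 0 a.
- have : sup A <= - ((a^-1 *: w) *m d) 0 0.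
    apply: ge_sup; first by exists ((wm *m d) 0 0), wm.
    move=> _ [w' Mw' <-]; apply: AB => //.
    rewrite -[1](mulVf (lt0r_neq0 a0)) -splitZ; apply: MZ => //.
    by rewrite invr_ge0 ltW.
  rewrite -scalemxAl mxE -(ler_pM2l a0) mulrN mulrA divff ?lt0r_neq0 // mul1r.
  by lra.
- have a0' : 0 < - a by rewrite oppr_gt0.
  have : (((- a)^-1 *: w) *m d) 0 0 <= sup A.
    apply: ub_le_sup; first by case: supA.
    exists ((- a)^-1 *: w) => //=.
    rewrite (_ : -1 = (- a)^-1 * a).
      by rewrite -splitZ; apply: MZ => //; rewrite invr_ge0 ltW.
    by field; rewrite ltr0_neq0.
  rewrite -scalemxAl mxE -(ler_pM2l a0') mulrA divff ?lt0r_neq0 // mul1r.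
  by lra.
- by rewrite -a0 mul0r add0r; apply: dM; rewrite /M0' /= a0.
Qed.

Import VectorInternalTheory.

(** Separating [x] from [M] amounts to finding a half-space that contains the cone
generated by [M] and [- x]; this cone does not contain [x], so it is proper. No
closedness is assumed, at the price that both inequalities are weak. *)
Lemma cone_separation (R : realType) (V : vectType R) (M : set V) (x : V) :
  convex_cone M -> ~ M x ->
  exists f : V -> R, [/\ forall a u v, f (a *: u + v) = a * f u + f v,
    exists u, f u != 0, forall u, M u -> f u <= 0 & 0 <= f x].
Proof.
move=> [M0 MD MZ] Mx.
pose M' : set 'rV[R]_(dim V) := [set w | exists2 a : R, 0 <= a & M (r2v w + a *: x)].
have [||c c0 cM] := @cone_halfspace_rV _ _ M'.
- split.
  + by exists 0 => //; rewrite linear0 scale0r addr0.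
  + move=> u v [a a0 Mu] [b b0 Mv]; exists (a + b); first exact: addr_ge0.
    by rewrite linearD scalerDl addrACA; exact: MD.
  + move=> t u t0 [a a0 Mu]; exists (t * a); first exact: mulr_ge0.
    by rewrite linearZ -scalerA -scalerDr; exact: MZ.
- exists (v2r x) => -[a a0]; rewrite v2rK -{1}[x]scale1r -scalerDl => Mu.
  have a1 : 0 < 1 + a by rewrite ltr_pwDl.
  apply: Mx; rewrite -[x](scalerK (lt0r_neq0 a1)).
  by apply: MZ => //; rewrite invr_ge0 ltW.
pose f v := (v2r v *m c) 0 0.
exists f; rewrite /f; split.
- by move=> a u v; rewrite linearP mulmxDl -scalemxAl !mxE.
- apply: contrapT => /forallNP f0; move/eqP: c0; apply.
  apply/colP => i; have /negP := f0 (r2v (delta_mx 0 i)).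
  by rewrite negbK r2vK -rowE mxE [in RHS]mxE => /eqP.
- by move=> u Mu; apply: cM; exists 0 => //; rewrite scale0r addr0 v2rK.
- have : M' (v2r (- x)) by exists 1 => //; rewrite v2rK scale1r addNr.
  by move/cM; rewrite linearN mulNmx mxE oppr_le0.
Qed.

(** * The inner product of pairs *)

Section InnerProduct.
Context {R : realType} {n k : nat}.
Implicit Types (z w u : gf R n k).

Lemma gf_ipDl z w u : gf_ip (z + w) u = gf_ip z u + gf_ip w u.
Proof.
rewrite /gf_ip /= !linearD /= !mulmxDl linearD /= [X in _ + X = _]mxE.
by rewrite addrACA.
Qed.

Lemma gf_ipZl a z u : gf_ip (a *: z) u = a * gf_ip z u.
Proof.
by rewrite /gf_ip /= !linearZ /= -!scalemxAl linearZ /= [X in _ + X = _]mxE -mulrDr.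
Qed.

Lemma gf_ip0l u : gf_ip 0 u = 0.
Proof. by rewrite -(scale0r (0 : gf R n k)) gf_ipZl mul0r. Qed.

Lemma gf_ipNl z u : gf_ip (- z) u = - gf_ip z u.
Proof. by rewrite -scaleN1r gf_ipZl mulN1r. Qed.

Lemma gf_ip_subl z w u : gf_ip (z - w) u = gf_ip z u - gf_ip w u.
Proof. by rewrite gf_ipDl gf_ipNl. Qed.

Lemma gf_ip_suml (I : finType) (F : I -> gf R n k) u :
  gf_ip (\sum_i F i) u = \sum_i gf_ip (F i) u.
Proof.
apply: (big_morph (fun z => gf_ip z u)); last exact: gf_ip0l.
by move=> z w; exact: gf_ipDl.
Qed.

Lemma gf_ipDr z w u : gf_ip u (z + w) = gf_ip u z + gf_ip u w.
Proof. by rewrite gf_ipC gf_ipDl !(gf_ipC u). Qed.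

Lemma gf_ipZr a z u : gf_ip u (a *: z) = a * gf_ip u z.
Proof. by rewrite gf_ipC gf_ipZl (gf_ipC u). Qed.

Lemma gf_ipBr z w u : gf_ip u (z - w) = gf_ip u z - gf_ip u w.
Proof. by rewrite gf_ipC gf_ip_subl !(gf_ipC u). Qed.

Lemma gf_norm0_eq0 z : gf_norm z = 0 -> z = 0.
Proof.
move=> z0; have : gf_ip z z = 0 by rewrite -gf_norm_sqr z0 expr0n.
have sq0 (x : R) : 0 <= x * x by rewrite -expr2 sqr_ge0.
rewrite gf_ipE => /eqP; rewrite paddr_eq0; last 2 first.
- by rewrite sumr_ge0 // => i _; rewrite sumr_ge0.
- by rewrite sumr_ge0.
rewrite !psumr_eq0 //; last by move=> i _; rewrite sumr_ge0.
case/andP => /allP h1 /allP h2; case: z {z0} h1 h2 => G F /= h1 h2.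
congr (_, _).
  apply/matrixP => i j; have := h1 i (mem_index_enum _).
  rewrite /= psumr_eq0 // => /allP/(_ j (mem_index_enum _)) /=.
  by rewrite mulf_eq0 orbb => /eqP ->; rewrite mxE.
apply/colP => i; have /= := h2 i (mem_index_enum _).
by rewrite mulf_eq0 orbb => /eqP ->; rewrite mxE.
Qed.

Lemma gf_norm0 : gf_norm (0 : gf R n k) = 0.
Proof. by rewrite gf_normE gf_ip0l sqrtr0. Qed.

Lemma gf_normZ a z : gf_norm (a *: z) = `|a| * gf_norm z.
Proof.
by rewrite !gf_normE gf_ipZl gf_ipZr mulrA -expr2 sqrtrM ?sqr_ge0 // sqrtr_sqr.
Qed.

Lemma gf_normN z : gf_norm (- z) = gf_norm z.
Proof. by rewrite -scaleN1r gf_normZ normrN1 mul1r. Qed.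

Lemma gf_norm_triangle z w : gf_norm (z + w) <= gf_norm z + gf_norm w.
Proof.
rewrite -(@ler_pXn2r _ 2) ?nnegrE ?addr_ge0 ?gf_norm_ge0 //.
rewrite sqrrD !gf_norm_sqr gf_ipDl !gf_ipDr (gf_ipC w z).
have := gf_cauchy_schwarz z w; lra.
Qed.

Lemma gf_normBC z w : gf_norm (z - w) = gf_norm (w - z).
Proof. by rewrite -gf_normN opprB. Qed.

Lemma gf_norm_le_sum (B : R) z :
  (forall i j, `|z.1 i j| <= B) -> (forall i, `|z.2 i 0| <= B) ->
  gf_norm z ^+ 2 <= \sum_(i < n.+1) \sum_(j < n.+1) B ^+ 2 + \sum_(i < k.+1) B ^+ 2.
Proof.
move=> B1 B2; rewrite gf_norm_sqr gf_ipE.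
have sq (x : R) : `|x| <= B -> x * x <= B ^+ 2.
  move=> xB; rewrite -expr2 -real_normK ?num_real //.
  by rewrite ler_pXn2r ?nnegrE // (le_trans _ xB).
apply: lerD; apply: ler_sum => i _; last exact/sq.
by apply: ler_sum => j _; exact/sq.
Qed.

End InnerProduct.

Section RieszRepresentation.
Context {R : realType}.

Lemma additive_of_linear (V : lmodType R) (f : V -> R) :
  (forall a u v, f (a *: u + v) = a * f u + f v) ->
  [/\ f 0 = 0, forall u v, f (u + v) = f u + f v & forall a u, f (a *: u) = a * f u].
Proof.
move=> fL; have fD u v : f (u + v) = f u + f v by rewrite -[u]scale1r fL mul1r scale1r.
have f0 : f 0 = 0 by apply: (addrI (f 0)); rewrite -fD !addr0.
by split=> // a u; rewrite -[a *: u]addr0 fL f0 addr0.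
Qed.

Lemma gf_riesz n k (f : gf R n k -> R) :
  (forall a u v, f (a *: u + v) = a * f u + f v) -> exists z, forall u, f u = gf_ip z u.
Proof.
move=> /additive_of_linear[f0 fD fZ].
have fsum (I : finType) (F : I -> gf R n k) : f (\sum_i F i) = \sum_i f (F i).
  exact: (big_morph f fD f0).
exists (\matrix_(i, j) f (delta_mx i j, 0), \col_i f (0, delta_mx i 0)) => -[G F].
have GFE : (G, F) = \sum_i \sum_j G i j *: (delta_mx i j, 0) +
    \sum_i F i 0 *: ((0, delta_mx i 0) : gf R n k) :> gf R n k.
  have fstS (I : finType) (H : I -> gf R n k) : (\sum_i H i).1 = \sum_i (H i).1.
    by apply: (big_morph fst).
  have sndS (I : finType) (H : I -> gf R n k) : (\sum_i H i).2 = \sum_i (H i).2.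
    by apply: (big_morph snd).
  congr (_, _).
    rewrite /= !fstS [X in _ = _ + X]big1 ?addr0 => [|i _]; last by rewrite /= scaler0.
    rewrite [LHS]matrix_sum_delta; apply: eq_bigr => i _; rewrite fstS.
    by apply: eq_bigr => j _.
  rewrite /= !sndS [X in _ = X + _]big1 ?add0r => [|i _].
    rewrite [LHS]matrix_sum_delta; apply: eq_bigr => i _.
    by rewrite big_ord1.
  by rewrite sndS big1 // => j _; rewrite /= scaler0.
rewrite [in LHS]GFE fD !fsum gf_ipE /=; congr (_ + _); last first.
  by apply: eq_bigr => i _; rewrite fZ !mxE mulrC.
apply: eq_bigr => i _; rewrite fsum.
by apply: eq_bigr => j _; rewrite fZ !mxE mulrC.
Qed.

(** The form in which separating functionals are used: on the product of copies of
the space of pairs and of the line, each block of coordinates is represented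
separately. *)
Lemma family_riesz n k (I : finType) (f : ({ffun I -> gf R n k * R^o} * R^o)%type -> R) :
  (forall a u v, f (a *: u + v) = a * f u + f v) ->
  exists (Z : I -> gf R n k) (w : I -> R) (q : R), forall u t,
    f (u, t) = \sum_i (gf_ip (Z i) (u i).1 + w i * (u i).2) + q * t.
Proof.
move=> /additive_of_linear[f0 fD fZ].
pose at_ i (a : gf R n k * R^o) : ({ffun I -> gf R n k * R^o} * R^o)%type :=
  ([ffun l => if l == i then a else 0], 0).
have atD i a b : at_ i (a + b) = at_ i a + at_ i b.
  congr (_, _); last by rewrite /= addr0.
  by apply/ffunP => l; rewrite !ffunE; case: eqP => _; rewrite ?addr0.
have atZ i x a : at_ i (x *: a) = x *: at_ i a.
  congr (_, _); last by rewrite /= scaler0.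
  by apply/ffunP => l; rewrite !ffunE; case: eqP => _; rewrite ?scaler0.
have atL i x a b : f (at_ i (x *: a + b)) = x * f (at_ i a) + f (at_ i b).
  by rewrite atD atZ fD fZ.
have Zex i : exists z, forall g, f (at_ i (g, 0)) = gf_ip z g.
  apply: gf_riesz => x a b; rewrite -atL; congr (f (at_ i (_, _))).
  by rewrite /= scaler0 addr0.
have [Z ZP] := choice Zex.
exists Z, (fun i => f (at_ i (0, 1))), (f (0, 1)) => u t.
have -> : (u, t) = \sum_i at_ i (u i) + t *: ((0, 1) : ({ffun I -> gf R n k * R^o} * R^o)%type).
  congr (_, _).
    rewrite /= scaler0 addr0 (big_morph fst (id1 := 0) (op1 := +%R)) //=.
    apply/ffunP => l; rewrite sum_ffunE (bigD1 l) //= ffunE eqxx big1 ?addr0 // => i il.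
    by rewrite ffunE eq_sym (negbTE il).
  rewrite /= (big_morph snd (id1 := 0) (op1 := +%R)) //= big1 // add0r.
  by rewrite /GRing.scale /= mulr1.
rewrite fD fZ (big_morph f fD f0); congr (_ + _); last exact: mulrC.
apply: eq_bigr => i _; case: (u i) => a b /=; rewrite -ZP.
rewrite -[_ * b]mulrC -fZ -fD -atZ -atD; congr (f (at_ i (_, _))) => /=.
  by rewrite scaler0 addr0.
by rewrite add0r /GRing.scale /= mulr1.
Qed.

End RieszRepresentation.

(** * Positive semidefinite matrices *)

Section Symmetric.
Context {R : realType} {n : nat}.
Implicit Types (A B : 'M[R]_n.+1).

Lemma sym_mxD A B : sym_mx A -> sym_mx B -> sym_mx (A + B).
Proof. by rewrite /sym_mx linearD /= => -> ->. Qed.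

Lemma sym_mxZ a A : sym_mx A -> sym_mx (a *: A).
Proof. by rewrite /sym_mx linearZ /= => ->. Qed.

Lemma sym_mxN A : sym_mx A -> sym_mx (- A).
Proof. by rewrite /sym_mx linearN /= => ->. Qed.

Lemma sym_mxB A B : sym_mx A -> sym_mx B -> sym_mx (A - B).
Proof. by move=> As /sym_mxN; exact: sym_mxD. Qed.

Lemma sym_mx_sum (I : finType) (F : I -> 'M[R]_n.+1) :
  (forall i, sym_mx (F i)) -> sym_mx (\sum_i F i).
Proof.
move=> Fs; rewrite /sym_mx linear_sum /=.
by apply: eq_bigr => i _; exact: Fs.
Qed.

Lemma sym_mx_outer (u v : 'cV[R]_n.+1) : sym_mx (sym_outer u v).
Proof.
by apply: sym_mxZ; rewrite /sym_mx linearD /= !trmx_mul !trmxK addrC.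
Qed.

End Symmetric.

Section QuadraticForm.
Context {R : realType} {n : nat}.
Implicit Types (G : 'M[R]_n.+1) (u v w : 'cV[R]_n.+1).

Definition quad G u v : R := (u^T *m G *m v) 0 0.

Lemma quadDl G u v w : quad G (u + v) w = quad G u w + quad G v w.
Proof. by rewrite /quad linearD /= !mulmxDl mxE. Qed.

Lemma quadZl G a u w : quad G (a *: u) w = a * quad G u w.
Proof. by rewrite /quad linearZ /= -!scalemxAl mxE. Qed.

Lemma quadC G u v : sym_mx G -> quad G u v = quad G v u.
Proof.
move=> Gs; rewrite /quad -[in LHS](trmxK (_ *m v)) [LHS]mxE.
by rewrite !trmx_mul trmxK Gs mulmxA.
Qed.

Lemma quadNl G u w : quad G (- u) w = - quad G u w.
Proof. by rewrite -scaleN1r quadZl mulN1r. Qed.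

Lemma quad_unit_col G (i j : 'I_n.+1) : quad G (unit_col n.+1 i) (unit_col n.+1 j) = G i j.
Proof.
have uE (l : 'I_n.+1) : unit_col n.+1 l = delta_mx l 0 :> 'cV[R]_n.+1.
  by apply/colP => a; rewrite !mxE eqxx andbT.
by rewrite /quad !uE trmx_delta -rowE -colE !mxE.
Qed.

Lemma tr_sym_outer_quad G u v : sym_mx G -> \tr ((sym_outer u v)^T *m G) = quad G u v.
Proof.
move=> Gs.
have tr_outer (a b : 'cV[R]_n.+1) : \tr (a *m b^T *m G) = quad G b a.
  by rewrite -mulmxA mxtrace_mulC /quad /mxtrace big_ord1.
rewrite /sym_outer linearZ linearD /= !trmx_mul !trmxK -scalemxAl mxtraceZ.
rewrite mulmxDl mxtraceD !tr_outer (quadC v u Gs).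
by field.
Qed.

Lemma tr_interp_quad G (k1 k2 k3 k4 : R) (u1 v1 u2 v2 u3 v3 u4 v4 : 'cV[R]_n.+1) :
  sym_mx G ->
  \tr ((sym_outer u1 v1 + k1 *: (k2 *: sym_outer u2 v2 + k3 *: sym_outer u3 v3
          - k4 *: sym_outer u4 v4))^T *m G) =
  quad G u1 v1 + k1 * (k2 * quad G u2 v2 + k3 * quad G u3 v3 - k4 * quad G u4 v4).
Proof.
move=> Gs; rewrite -!(tr_sym_outer_quad _ _ Gs).
move: (sym_outer u1 v1) (sym_outer u2 v2) (sym_outer u3 v3) (sym_outer u4 v4).
move=> A1 A2 A3 A4; pose q (A : 'M[R]_n.+1) := \tr (A^T *m G).
have qD A B : q (A + B) = q A + q B by rewrite /q linearD /= mulmxDl mxtraceD.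
have qZ a A : q (a *: A) = a * q A by rewrite /q linearZ /= -scalemxAl mxtraceZ.
have qN A : q (- A) = - q A by rewrite -scaleN1r qZ mulN1r.
by rewrite -!/(q _) !(qD, qZ, qN).
Qed.

End QuadraticForm.

Section PsdForm.
Context {R : realType} {n : nat}.
Variable G : 'M[R]_n.+1.
Hypothesis Gpsd : psd G.
Implicit Types (u v w : 'cV[R]_n.+1).

Lemma psd_quad_ge0 u : 0 <= quad G u u. Proof. exact: Gpsd.2. Qed.

Lemma psd_quadDr u v w : quad G w (u + v) = quad G w u + quad G w v.
Proof. by rewrite quadC ?quadDl; [rewrite !(quadC _ w) //|]; case: Gpsd. Qed.

Lemma psd_quadNr u w : quad G w (- u) = - quad G w u.
Proof. by rewrite quadC ?quadNl; [rewrite (quadC _ w) //|]; case: Gpsd. Qed.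

Lemma psd_quadZr a u w : quad G w (a *: u) = a * quad G w u.
Proof. by rewrite quadC ?quadZl; [rewrite (quadC _ w) //|]; case: Gpsd. Qed.

Lemma psd_quad_le u v : quad G u v <= (quad G u u + quad G v v) / 2.
Proof.
have := psd_quad_ge0 (u - v).
rewrite quadDl quadNl !psd_quadDr !psd_quadNr (quadC v u) //; last by case: Gpsd.
lra.
Qed.

Lemma psd_quadD_le u v : quad G (u + v) (u + v) <= 2 * (quad G u u + quad G v v).
Proof.
have := psd_quad_ge0 (u - v).
rewrite !quadDl !quadNl !psd_quadDr !psd_quadNr (quadC v u) //; last by case: Gpsd.
lra.
Qed.

(** Bounding the diagonal of a positive semidefinite matrix bounds the matrix. *)
Lemma psd_entry_le i j : `|G i j| <= (G i i + G j j) / 2.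
Proof.
rewrite -!quad_unit_col; set u := unit_col _ i; set v := unit_col _ j.
rewrite ler_norml psd_quad_le andbT lerNl -quadNl.
by apply: le_trans (psd_quad_le _ _) _; rewrite quadNl psd_quadNr opprK.
Qed.

End PsdForm.

(** Testing against [v *m v^T] gives nonnegativity, and testing against the
antisymmetric matrices, whose form vanishes, gives symmetry. The symmetry of [A]
is thus encoded in the range of [S], which is not restricted to symmetric
matrices. *)
Lemma psd_self_dual (R : realType) n (A : 'M[R]_n.+1) :
  (forall S, (forall v, 0 <= quad S v v) -> 0 <= \tr (A^T *m S)) -> psd A.
Proof.
move=> AS.
have quad_outer (u v a : 'cV[R]_n.+1) :
    quad (u *m v^T) a a = (a^T *m u) 0 0 * (v^T *m a) 0 0.
  by rewrite /quad mulmxA -mulmxA mxE big_ord1.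
have tr_outer (u v : 'cV[R]_n.+1) : \tr (A^T *m (u *m v^T)) = quad A u v.
  rewrite mulmxA mxtrace_mulC /quad /mxtrace big_ord1.
  by rewrite -[in LHS](trmxK (v^T *m _)) [LHS]mxE !trmx_mul !trmxK.
have dotC (u v : 'cV[R]_n.+1) : (u^T *m v) 0 0 = (v^T *m u) 0 0.
  by rewrite -[in LHS](trmxK (_ *m v)) [LHS]mxE trmx_mul trmxK.
split=> [|v]; last first.
  rewrite -/(quad A v v) -tr_outer; apply: AS => a.
  by rewrite quad_outer dotC -expr2 sqr_ge0.
suff AC i j : A i j <= A j i.
  by apply/matrixP => i j; rewrite mxE; apply/le_anti/andP.
rewrite -!quad_unit_col; set u := unit_col _ i; set v := unit_col _ j.
rewrite -subr_ge0 -!tr_outer -raddfB -mulmxBr /=; apply: AS => a.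
have -> : quad (v *m u^T - u *m v^T) a a = quad (v *m u^T) a a - quad (u *m v^T) a a.
  by rewrite /quad mulmxBr mulmxBl !mxE.
by rewrite !quad_outer dotC (dotC u) mulrC subrr.
Qed.

Section TracePsd.
Context {R : realType} {n : nat}.
Implicit Types (G S : 'M[R]_n.+1) (u v : 'cV[R]_n.+1).

Lemma psd_quad_null G u v : psd G -> quad G v v = 0 -> quad G u v = 0.
Proof.
move=> Gpsd v0; apply/eqP; apply: contraT => uv0.
(* the multiple of [v] that brings the form of the sum down to -1 *)
have := psd_quad_ge0 Gpsd (u + (- (quad G u u + 1) / (2 * quad G u v)) *: v).
rewrite quadDl !(psd_quadDr Gpsd) !quadZl !(psd_quadZr Gpsd) v0 !mulr0 addr0.
rewrite (quadC v u); last by case: Gpsd.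
have -> : (- (quad G u u + 1) / (2 * quad G u v)) * quad G u v = - (quad G u u + 1) / 2.
  by field.
lra.
Qed.

(** The inequality of Cauchy and Schwarz for the form of [G], divided by
[quad G v v]: it says that the Schur complement of [v] is nonnegative. *)
Lemma psd_schur G u v : psd G -> 0 < quad G v v ->
  quad G u v ^+ 2 / quad G v v <= quad G u u.
Proof.
move=> Gpsd v0.
have := psd_quad_ge0 Gpsd (u - (quad G u v / quad G v v) *: v).
rewrite quadDl !(psd_quadDr Gpsd) !quadNl !(psd_quadNr Gpsd) !quadZl !(psd_quadZr Gpsd).
rewrite (quadC v u); last by case: Gpsd.
suff -> : quad G u v / quad G v v * (quad G u v / quad G v v * quad G v v) =
  quad G u v ^+ 2 / quad G v v by lra.
by field; rewrite lt0r_neq0.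
Qed.

(** [G] is a sum of matrices [v *m v^T], which are peeled off one at a time:
subtracting the rank-one matrix of the last nonzero column leaves the Schur
complement, again positive semidefinite, with one more zero row. *)
Lemma psd_tr_ge0 S G : (forall v, 0 <= quad S v v) -> psd G -> 0 <= \tr (S^T *m G).
Proof.
move=> S0.
suff ind k : forall G, psd G -> (forall i j : 'I_n.+1, (k <= i)%N -> G i j = 0) ->
    0 <= \tr (S^T *m G).
  by move=> Gpsd; apply: (ind n.+1) => // i j; rewrite leqNgt ltn_ord.
elim: k => [|k IH] {}G Gpsd G0.
  rewrite (_ : G = 0) ?mulmx0 ?mxtrace0 //.
  by apply/matrixP => i j; rewrite G0 // mxE.
have Gs : sym_mx G by case: Gpsd.
have [nk|kn] := leqP n.+1 k.
  by apply: IH => // i j ki; have := ltn_ord i; rewrite ltnNge (leq_trans nk ki).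
pose l := Ordinal kn; pose e : 'cV[R]_n.+1 := unit_col n.+1 l.
have eE i : quad G (unit_col n.+1 (i : 'I_n.+1)) e = G i l by exact: quad_unit_col.
have [Gll|Gll] := eqVneq (G l l) 0.
  apply: IH => // i j; rewrite leq_eqVlt => /orP[/eqP ki|]; last exact: G0.
  have -> : i = l by exact: val_inj.
  rewrite -[G]Gs mxE -eE; apply: psd_quad_null => //.
  by rewrite quad_unit_col.
have a0 : 0 < G l l by rewrite lt0r Gll -quad_unit_col psd_quad_ge0.
pose v := col l G.
have vE u : (u^T *m v) 0 0 = quad G u e.
  rewrite /v colE /quad mulmxA; congr ((_ *m _) 0 0).
  by apply/colP => i; rewrite !mxE andbT.
pose G' := G - (G l l)^-1 *: (v *m v^T).
have G'psd : psd G'.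
  split=> [|u].
    by apply: sym_mxB => //; apply: sym_mxZ; rewrite /sym_mx trmx_mul trmxK.
  rewrite /G' mulmxBr mulmxBl mxE [X in _ + X]mxE -scalemxAr -scalemxAl [X in _ - X]mxE.
  have -> : (u^T *m (v *m v^T) *m u) 0 0 = quad G u e ^+ 2.
    rewrite mulmxA -mulmxA mxE big_ord1 vE -vE expr2; congr (_ * _).
    by rewrite -[in LHS](trmxK (_ *m u)) [LHS]mxE trmx_mul trmxK.
  rewrite subr_ge0 mulrC -[G l l]eE; apply: psd_schur => //.
  by rewrite eE.
have -> : G = G' + (G l l)^-1 *: (v *m v^T) by rewrite subrK.
rewrite mulmxDr mxtraceD addr_ge0 //.
  apply: IH => // i j; rewrite /G' !mxE big_ord1 !mxE leq_eqVlt => /orP[/eqP ki|ki].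
    have -> : i = l by exact: val_inj.
    by rewrite -[in G l j]Gs mxE mulrA mulVf // mul1r subrr.
  by rewrite (G0 i j ki) (G0 i l ki) mul0r mulr0 subr0.
rewrite -scalemxAr mxtraceZ mulr_ge0 ?invr_ge0 ?(ltW a0) //.
rewrite mulmxA mxtrace_mulC mulmxA /mxtrace big_ord1.
by rewrite -[_ *m v]trmxK mxE !trmx_mul !trmxK mulmxA; exact: S0.
Qed.

End TracePsd.

(** * Boundedness of the lifted set *)

Section Bounded.
Context {R : realType}.
Variables (K : nat) (eta : nat -> nat -> R) (mu L r : R).
Hypotheses (mu_ge0 : 0 <= mu) (mu_lt_L : mu < L).
Let Z := lifted_set (K := K) eta mu L r.
Let x := x_coord (K := K) eta.
Let g := g_coord (R := R) (K := K).

Lemma gf_ip_coord (z : gf R K.+1 K) (A : 'M[R]_K.+2) (f : 'cV[R]_K.+1) :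
  gf_ip (A, f) z = \tr (A^T *m z.1) + (f^T *m z.2) 0 0.
Proof. by []. Qed.

Lemma unit_col_tr (F : 'cV[R]_K.+1) (l : 'I_K.+1) : ((unit_col K.+1 l)^T *m F) 0 0 = F l 0.
Proof.
rewrite mxE (bigD1 l) //= big1 => [|j jN].
  by rewrite !mxE eqxx mul1r addr0.
by rewrite !mxE -[(j : nat) == l]/(j == l) (negbTE jN) mul0r.
Qed.

Definition interp_pair p q (pq : p != q) : index_pair K :=
  exist (fun m : interp_index K * interp_index K => m.1 != m.2) (p, q) pq.

Lemma gf_ip_interp_quad (z : gf R K.+1 K) p q (pq : p != q) : sym_mx z.1 ->
  gf_ip (interp_data eta mu L (interp_pair pq)) z =
  quad z.1 (g q) (x p - x q) + (2 * (1 - mu / L))^-1 *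
    (L^-1 * quad z.1 (g p - g q) (g p - g q) + mu * quad z.1 (x p - x q) (x p - x q)
     - 2 * mu / L * quad z.1 (g q - g p) (x q - x p))
  + (if q is Some l then z.2 l 0 else 0) - (if p is Some l then z.2 l 0 else 0).
Proof.
move=> Gs; rewrite /interp_data /interp_pair [val _]/= gf_ip_coord.
have tE := tr_interp_quad (2 * (1 - mu / L))^-1 L^-1 mu (2 * mu / L) (g q) (x p - x q)
  (g p - g q) (g p - g q) (x p - x q) (x p - x q) (g q - g p) (x q - x p) Gs.
rewrite -[in RHS]addrA -tE.
congr (_ + _).
have fE (o : interp_index K) :
    ((f_coord o)^T *m z.2) 0 0 = if o is Some l then z.2 l 0 else 0.
  by case: o => [l|]; [exact: unit_col_tr | rewrite trmx0 mul0mx mxE].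
by rewrite linearB /= mulmxBl mxE fE [X in _ + X = _]mxE fE.
Qed.

(** With [a = |g|^2], [b = |x|^2], [c = <g, x>], the inequalities between the
minimizer and the iterate read [k <= f <= c - k], where
[2 * (L - mu) * k = a + mu * L * b - 2 * mu * c]. This [k] is nonnegative since
[|g - mu x|^2] is, and [2 * k <= c] gives [a + mu * L * b <= (L + mu) * c]; now
[c] is bounded by expanding [|g - (L + mu) x|^2]. *)
Lemma lifted_set_step (z : gf R K.+1 K) (l : 'I_K.+1) : Z z ->
  let: (xl, gl) := (x (Some l), g (Some l)) in
  quad z.1 gl gl <= (L + mu) ^+ 2 * quad z.1 xl xl /\
  0 <= z.2 l 0 <= quad z.1 gl xl.
Proof.
move=> [Gpsd interp _]; set xl := x _; set gl := g _.
have Gs : sym_mx z.1 by case: Gpsd.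
have [x0 g0] : x None = 0 /\ g None = 0 by [].
have q0 u : quad z.1 0 u = 0 by rewrite -(scale0r u) quadZl mul0r.
have := interp (@interp_pair (Some l) None isT); have := interp (@interp_pair None (Some l) isT).
rewrite !gf_ip_interp_quad // -/xl -/gl x0 g0 /= !(subr0, sub0r, addr0).
rewrite !(quadNl, psd_quadNr Gpsd, opprK) q0 add0r.
set a := quad _ gl gl; set b := quad _ xl xl; set c := quad _ gl xl; set F := z.2 l 0.
set k := (2 * _)^-1 * _ => starl lstar.
have L0 : 0 < L by exact: le_lt_trans mu_lt_L.
have kE : 2 * (L - mu) * k = a + mu * L * b - 2 * mu * c.
  rewrite /k; field; rewrite lt0r_neq0 //= lt0r_neq0 // subr_gt0 //.
have := psd_quad_ge0 Gpsd (gl - mu *: xl).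
have := psd_quad_ge0 Gpsd (gl - (L + mu) *: xl).
rewrite !quadDl !quadNl !(psd_quadDr Gpsd) !(psd_quadNr Gpsd) !quadZl.
rewrite !(psd_quadZr Gpsd) (quadC xl gl Gs) -/a -/b -/c => sq1 sq2.
have b0 : 0 <= b by exact: psd_quad_ge0.
have mub : mu * mu * b <= mu * L * b by rewrite ler_wpM2r // ler_wpM2l // ltW.
have k0 : 0 <= k.
  rewrite -(@pmulr_rge0 _ (2 * (L - mu))) ?mulr_gt0 ?subr_gt0 //.
  by rewrite kE; lra.
have kc : 2 * (L - mu) * k <= (L - mu) * c.
  have k2c : 2 * k <= c by lra.
  by rewrite -mulrA mulrCA ler_wpM2l // subr_ge0 ltW.
split; last by apply/andP; split; lra.
have mLb : 0 <= mu * L * b by rewrite !mulr_ge0 // ltW.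
by rewrite expr2; lra.
Qed.

(** A uniform bound passes to sums and multiples of vectors, hence to an iterate
from [x_0] and the gradients that precede it. *)
Lemma quad_le_iterate (S : set (gf R K.+1 K)) (l : nat) :
  (forall z, S z -> psd z.1) ->
  (exists B, forall z, S z -> quad z.1 (unit_col K.+2 0) (unit_col K.+2 0) <= B) ->
  (forall i, (i < l)%N -> exists B, forall z, S z ->
     quad z.1 (unit_col K.+2 i.+1) (unit_col K.+2 i.+1) <= B) ->
  exists B, forall z, S z ->
    let xl := iterate eta (unit_col K.+2 0) (fun i => unit_col K.+2 i.+1) l in
    quad z.1 xl xl <= B.
Proof.
move=> Spsd; pose bd u := exists B, forall z, S z -> quad z.1 u u <= B.
have bdD u v : bd u -> bd v -> bd (u + v).
  move=> [B Bu] [C Cv]; exists (2 * (B + C)) => z Sz.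
  apply: le_trans (psd_quadD_le (Spsd _ Sz) _ _) _.
  by rewrite ler_pM2l // lerD ?Bu ?Cv.
have bdZ a u : bd u -> bd (a *: u).
  move=> [B Bu]; exists (a ^+ 2 * B) => z Sz.
  rewrite quadZl (psd_quadZr (Spsd _ Sz)) mulrA -expr2.
  by rewrite ler_wpM2l ?sqr_ge0 ?Bu.
have bd0 : bd 0.
  by exists 0 => z Sz; rewrite -(scale0r 0) quadZl mul0r.
move=> bdx; elim: l => [|l IH] bdg /=.
  exact: bdx.
apply: (bdD); first by apply: IH => i il; apply: bdg; rewrite ltnW.
rewrite -scaleN1r; apply: (bdZ (-1)).
apply: (big_ind bd) => // i _; apply: bdZ; exact: bdg.
Qed.

(** Alternates [quad_le_iterate] and [lifted_set_step] along the iterates. *)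
Lemma lifted_set_bounded : exists B, forall z, Z z -> gf_norm z <= B.
Proof.
have Zpsd z : Z z -> psd z.1 by case.
pose u i : 'cV[R]_K.+2 := unit_col K.+2 i.
have u0 : exists B, forall z, Z z -> quad z.1 (u 0) (u 0) <= B.
  exists (r ^+ 2) => z [_ _]; rewrite /init_const subr_le0 /gf_ip /= trmx0.
  rewrite mul0mx [X in _ + X]mxE addr0 trmx_delta /=.
  rewrite -(mul_delta_mx (0 : 'I_1)) -mulmxA mxtrace_mulC -rowE -colE.
  by rewrite /mxtrace big_ord1 (quad_unit_col z.1 0 0) !mxE.
have ug i : (i < K.+1)%N -> exists B, forall z, Z z -> quad z.1 (u i.+1) (u i.+1) <= B.
  elim/ltn_ind: i => i IH iK.
  have [B xB] := quad_le_iterate Zpsd u0 (fun j ji => IH j ji (ltn_trans ji iK)).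
  exists ((L + mu) ^+ 2 * B) => z Zz.
  have [gB _] := lifted_set_step (Ordinal iK) Zz.
  by apply: le_trans gB _; rewrite ler_wpM2l ?sqr_ge0 //; exact: xB.
have uB (i : 'I_K.+2) : exists B, forall z, Z z -> z.1 i i <= B.
  have [B h] : exists B, forall z, Z z -> quad z.1 (u i) (u i) <= B.
    by case: i => -[|i] iK //=; exact: ug.
  by exists B => z Zz; rewrite -quad_unit_col; exact: h.
have fB (l : 'I_K.+1) : exists B, forall z, Z z -> `|z.2 l 0| <= B.
  have [B xB] := quad_le_iterate Zpsd u0 (fun j ji => ug j (ltn_trans ji (ltn_ord l))).
  have [C gC] := ug l (ltn_ord l).
  exists ((C + B) / 2) => z Zz; have [_ /andP[F0 FB]] := lifted_set_step l Zz.
  rewrite ger0_norm //; apply: le_trans FB _.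
  apply: le_trans (psd_quad_le (Zpsd _ Zz) _ _) _.
  by rewrite ler_pM2r // lerD //; [exact: gC | exact: xB].
have [bu buP] := choice uB; have [bf bfP] := choice fB.
pose C := \sum_i `|bu i| + \sum_l `|bf l|.
have buC i : bu i <= C.
  rewrite /C (bigD1 i) //= -addrA ler_wpDr ?ler_norm //.
  by rewrite addr_ge0 ?sumr_ge0.
have bfC l : bf l <= C.
  rewrite /C [X in _ + X](bigD1 l) //= addrCA ler_wpDr ?ler_norm //.
  by rewrite addr_ge0 ?sumr_ge0.
pose D := \sum_(i < K.+2) \sum_(j < K.+2) C ^+ 2 + \sum_(i < K.+1) C ^+ 2.
exists (1 + D) => z Zz.
have zD : gf_norm z ^+ 2 <= D.
  apply: gf_norm_le_sum => [i j|l].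
    apply: le_trans (psd_entry_le (Zpsd _ Zz) i j) _.
    have := buP i z Zz; have := buP j z Zz; have := buC i; have := buC j; lra.
  by apply: le_trans (bfP l z Zz) _.
have := sqr_ge0 (gf_norm z - 1); rewrite sqrrB expr1n.
have := gf_norm_ge0 z; lra.
Qed.

End Bounded.

(** * Strong duality of the finite-dimensional problems *)

(** Specializes an inequality on a sum to each of its terms, by leaving all the
other arguments at the value [x0] where the terms vanish. *)
Lemma sum_le0_local (R : realType) (I : finType) (T : Type) (P : set T) (x0 : T)
    (F : I -> T -> R) :
  P x0 -> (forall i, F i x0 = 0) ->
  (forall h : I -> T, (forall i, P (h i)) -> \sum_i F i (h i) <= 0) ->
  forall i x, P x -> F i x <= 0.
Proof.
move=> Px0 F0 FP i x Px; have := FP (fun l => if l == i then x else x0).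
rewrite (bigD1 i) //= eqxx big1 ?addr0 => [|l /negbTE -> //]; apply => l.
by case: eqP.
Qed.

Lemma sum_pair (R : realType) N J (F : 'I_N * 'I_J -> R) :
  \sum_p F p = \sum_i \sum_j F (i, j).
Proof. by rewrite pair_big; apply: eq_bigr => -[]. Qed.

Lemma sym_interp_data (R : realType) K eta (mu L : R) (m : index_pair K) :
  sym_mx (interp_data eta mu L m).1.
Proof.
rewrite /interp_data; case: (val m) => p q /=.
apply: sym_mxD; first exact: sym_mx_outer.
apply: sym_mxZ; apply: sym_mxB; last by apply: sym_mxZ; exact: sym_mx_outer.
by apply: sym_mxD; apply: sym_mxZ; exact: sym_mx_outer.
Qed.

Section ConicDuality.
Context {R : realType}.
Variables (K : nat) (eta : nat -> nat -> R) (mu L r : R).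
Variables (N J : nat) (zhat : 'I_N -> gf R K.+1 K).
Variables (obj : 'I_J -> gf R K.+1 K) (c : 'I_J -> R) (eps : R).
Hypotheses (mu_ge0 : 0 <= mu) (mu_lt_L : mu < L) (N_gt0 : (0 < N)%N).
Hypothesis zhat_lifted : forall i, lifted_set eta mu L r (zhat i).
Hypothesis obj_sym : forall j, sym_mx (obj j).1.

Let IJ := ('I_N * 'I_J)%type.
Let GF := gf R K.+1 K.
Let Z := lifted_set (K := K) eta mu L r.
Let A := interp_data (K := K) eta mu L.
Let A0 : GF := init_data K.
Let c0 := init_const r.

(** The homogenization of the lifted set: [z] is [w] times a point of it. *)
Definition lifted_cone (z : GF) (w : R) : Prop :=
  [/\ psd z.1, forall m, gf_ip (A m) z <= 0, gf_ip A0 z + c0 * w <= 0 & 0 <= w].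

Lemma lifted_cone_pos z w : lifted_cone z w -> 0 < w -> Z (w^-1 *: z).
Proof.
move=> [[zs zp] zA zA0 _] w0; have w1 : 0 <= w^-1 by rewrite invr_ge0 ltW.
split=> [|m|].
- split=> [|v]; first by rewrite /sym_mx /= linearZ /= zs.
  by rewrite /= -scalemxAr -scalemxAl mxE mulr_ge0.
- by rewrite gf_ipZr mulr_ge0_le0.
- rewrite gf_ipZr -(pmulr_rle0 _ w0) mulrDr mulrA divff ?lt0r_neq0 // mul1r.
  by rewrite [w * _]mulrC.
Qed.

(** The recession cone of a bounded set is trivial: if [z] is in it, so are all its
multiples, and they lie in the lifted set. *)
Lemma lifted_cone0 z : lifted_cone z 0 -> z = 0.
Proof.
move=> [[zs zp] zA zA0 _].
have [B ZB] := lifted_set_bounded K eta r mu_ge0 mu_lt_L.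
have kZ k : 0 <= k -> Z (k *: z).
  move=> k0; split=> [|m|].
  - split=> [|v]; first by rewrite /sym_mx /= linearZ /= zs.
    by rewrite /= -scalemxAr -scalemxAl mxE mulr_ge0.
  - by rewrite gf_ipZr mulr_ge0_le0.
  - rewrite gf_ipZr /init_const -/A0.
    have := mulr_ge0_le0 k0 zA0; rewrite mulr0 addr0.
    by have := sqr_ge0 r; lra.
apply: gf_norm0_eq0; apply/eqP; rewrite eq_le gf_norm_ge0 andbT leNgt.
apply/negP => z0.
have B0 : 0 <= B by exact: le_trans (gf_norm_ge0 _) (ZB _ (kZ 0 (lexx 0))).
have k0 : 0 <= (B + 1) / gf_norm z by rewrite divr_ge0 ?addr_ge0 // ltW.
have := ZB _ (kZ _ k0).
by rewrite gf_normZ ger0_norm // divfK ?lt0r_neq0 //; lra.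
Qed.

Definition dual_slack (y : index_pair K -> R) (xy : GF) (tau : R) (a : GF) : GF :=
  \sum_m y m *: A m - xy + tau *: A0 - a.

Lemma dual_slackD y y' xy xy' tau tau' a a' :
  dual_slack (fun m => y m + y' m) (xy + xy') (tau + tau') (a + a') =
  dual_slack y xy tau a + dual_slack y' xy' tau' a'.
Proof.
rewrite /dual_slack; under eq_bigr do rewrite scalerDl.
rewrite big_split /= scalerDl !opprD.
by rewrite (addrACA _ _ (- xy)) (addrACA _ _ (tau *: A0)) (addrACA _ _ (- a)).
Qed.

Lemma dual_slackZ k y xy tau a :
  dual_slack (fun m => k * y m) (k *: xy) (k * tau) (k *: a) =
  k *: dual_slack y xy tau a.
Proof.
rewrite /dual_slack !scalerBr scalerDr scalerBr scalerA scaler_sumr.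
by under eq_bigr do rewrite -scalerA.
Qed.

(** The right-hand sides [(u, k)] for which the dual constraints are solvable when
[(obj j, 0)] is replaced by [u (i, j)] and when the cost must not exceed [k]. The
slack matrix is only asked to have a nonnegative form, so that the cone is stable
under antisymmetric perturbations of the matrices in [u] and functionals that are
nonpositive on it are symmetric; [dual_cone_feasible] recovers the symmetry of the
slack from that of the data. *)
Definition dual_cone : set ({ffun IJ -> GF * R^o} * R^o)%type :=
  [set e : ({ffun IJ -> GF * R^o} * R^o)%type |
    exists (s : 'I_N -> R) (t lam : R) (tau : IJ -> R) (xy : IJ -> GF)
      (y : IJ -> index_pair K -> R),
    [/\ 0 <= lam, N%:R^-1 * \sum_i s i <= (e.2 : R) & forall p,
      [/\ 0 <= tau p /\ (forall m, 0 <= y p m),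
          sym_mx (xy p).1 /\ gf_norm (xy p) <= lam,
          ((e.1 p).2 : R) <= s p.1 - c p.2 * t + c0 * tau p
                     + gf_ip (xy p) (zhat p.1) - lam * eps,
          forall v, 0 <= quad (dual_slack (y p) (xy p) (tau p) (e.1 p).1).1 v v &
          (dual_slack (y p) (xy p) (tau p) (e.1 p).1).2 = 0]]].

Lemma dual_cone_convex : convex_cone dual_cone.
Proof.
split.
- have -> : 0 = ([ffun=> 0], 0) :> ({ffun IJ -> GF * R^o} * R^o)%type.
    by congr (_, _); apply/ffunP => p; rewrite !ffunE.
  exists (fun=> 0), 0, 0, (fun=> 0), (fun=> 0), (fun _ _ => 0).
  split=> // [|p]; first by rewrite big1 ?mulr0.
  have -> : dual_slack (fun=> 0) 0 0 (([ffun=> 0] : {ffun IJ -> GF * R^o}) p).1 = 0.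
    by rewrite /dual_slack big1 ?ffunE ?scale0r ?subr0 ?addr0 // => m _; rewrite scale0r.
  split=> //.
  + by split; [rewrite /sym_mx /= trmx0 | rewrite /= gf_norm0 lexx].
  + by rewrite /= ffunE gf_ip0l !mulr0 mul0r !addr0 !subr0 lexx.
  + by move=> v; rewrite /quad mulmx0 mul0mx mxE.
- move=> [u1 u2] [v1 v2] [s [t [lam [tau [xy [y [lam0 us uP]]]]]]].
  move=> [s' [t' [lam' [tau' [xy' [y' [lam0' vs vP]]]]]]].
  have -> : (u1, u2) + (v1, v2) = ([ffun q => u1 q + v1 q], u2 + v2)
    :> ({ffun IJ -> GF * R^o} * R^o)%type by [].
  exists (fun i => s i + s' i), (t + t'), (lam + lam'), (fun p => tau p + tau' p),
    (fun p => xy p + xy' p), (fun p m => y p m + y' p m).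
  split=> [||p]; first exact: addr_ge0.
    by rewrite big_split /= mulrDr lerD.
  have [[tau0 y0] [xys xyl] u2P uG uF] := uP p.
  have [[tau0' y0'] [xys' xyl'] v2P vG vF] := vP p.
  have -> : (([ffun q => u1 q + v1 q] : {ffun IJ -> GF * R^o}) p).1 = (u1 p).1 + (v1 p).1.
    by rewrite ffunE.
  rewrite ffunE dual_slackD; split.
  + by split=> [|m]; rewrite addr_ge0.
  + split; first by rewrite /sym_mx /= linearD /= xys xys'.
    by apply: le_trans (gf_norm_triangle _ _) _; rewrite lerD.
  + by apply: le_trans (lerD u2P v2P) _; rewrite gf_ipDl; lra.
  + move=> v; rewrite /= /quad mulmxDr mulmxDl mxE.
    by rewrite addr_ge0 //; [exact: uG | exact: vG].
  + exact: (etrans (congr2 +%R uF vF) (addr0 0)).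
- move=> k [u1 u2] k0 [s [t [lam [tau [xy [y [lam0 us uP]]]]]]].
  have -> : k *: (u1, u2) = (k *: u1, k *: u2) :> ({ffun IJ -> GF * R^o} * R^o)%type by [].
  exists (fun i => k * s i), (k * t), (k * lam), (fun p => k * tau p),
    (fun p => k *: xy p), (fun p m => k * y p m).
  split=> [||p]; first exact: mulr_ge0.
    by rewrite -mulr_sumr mulrCA; apply: ler_wpM2l.
  have [[tau0 y0] [xys xyl] u2P uG uF] := uP p.
  have -> : ((k *: u1) p).1 = k *: (u1 p).1 by rewrite ffunE.
  rewrite ffunE dual_slackZ; split.
  + by split=> [|m]; rewrite mulr_ge0.
  + split; first by rewrite /sym_mx /= linearZ /= xys.
    by rewrite gf_normZ ger0_norm // ler_wpM2l.
  + by apply: le_trans (ler_wpM2l k0 u2P) _; rewrite gf_ipZl; lra.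
  + move=> v; rewrite /= /quad -scalemxAr -scalemxAl mxE.
    by rewrite mulr_ge0 //; exact: uG.
  + exact: (etrans (congr1 (GRing.scale k) uF) (scaler0 _ k)).
Qed.

Lemma dual_cone_feasible v : dual_cone ([ffun p => (obj p.2, 0)], v) ->
  exists s t lam tau xy y,
    dual_feasible eta mu L r zhat obj c eps s t lam tau xy y /\
    N%:R^-1 * \sum_i s i <= v.
Proof.
move=> [s [t [lam [tau [xy [y [lam0 us uP]]]]]]].
exists s, t, lam, (fun i j => tau (i, j)), (fun i j => xy (i, j)), (fun i j => y (i, j)).
split=> //; split=> // i j.
have [[tau0 y0] [xys xyl] sP G F] := uP (i, j).
move: sP G F; rewrite /= ffunE /= => sP G F.
have fstS (H : index_pair K -> GF) : (\sum_i H i).1 = \sum_i (H i).1.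
  exact: (big_morph fst).
have sndS (H : index_pair K -> GF) : (\sum_i H i).2 = \sum_i (H i).2.
  exact: (big_morph snd).
split=> //; split.
- by rewrite -/c0; lra.
- split; last by move=> v'; have := G v'; rewrite /dual_slack /= fstS.
  apply: sym_mxB (obj_sym j); apply: sym_mxD.
    apply: sym_mxB xys; apply: sym_mx_sum => m.
    by apply: sym_mxZ; exact: sym_interp_data.
  by apply: sym_mxZ; rewrite /sym_mx trmx_delta.
- by move: F; rewrite /dual_slack /= sndS.
- by rewrite gf_dual_normE.
Qed.

(** Each dual variable produces one primal constraint: the slacks and the multipliers
[y] and [tau] put [(z p, w p)] into the cone over the lifted set, the free variables
[s] and [t] give the two equations of [Gamma], and [xy] and [lam] give the transport
constraint. *)
Lemma dual_cone_polar (z : IJ -> GF) (w : IJ -> R) (q : R) :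
  (forall u k, dual_cone (u, k) ->
     \sum_p (gf_ip (z p) (u p).1 + w p * (u p).2) + q * k <= 0) ->
  [/\ forall p, lifted_cone (z p) (w p), q <= 0,
      forall i, \sum_j w (i, j) = - q / N%:R,
      \sum_p w p * c p.2 = 0 &
      \sum_p gf_norm (z p - w p *: zhat p.1) <= eps * - q].
Proof.
move=> polar.
have test s t lam tau xy y (S : IJ -> 'M[R]_K.+2) (rho : IJ -> R) sigma :
    0 <= lam -> 0 <= sigma ->
    (forall p, [/\ 0 <= tau p, forall m, 0 <= y p m,
       sym_mx (xy p).1 /\ gf_norm (xy p) <= lam, 0 <= rho p &
       forall v, 0 <= quad (S p) v v]) ->
    \sum_p (gf_ip (z p) (\sum_m y p m *: A m - xy p + tau p *: A0 - (S p, 0))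
           + w p * (s p.1 - c p.2 * t + c0 * tau p + gf_ip (xy p) (zhat p.1)
                    - lam * eps - rho p))
      + q * (N%:R^-1 * \sum_i s i + sigma) <= 0.
  move=> lam0 sigma0 pP.
  pose u : {ffun IJ -> GF * R^o} := [ffun p =>
    (\sum_m y p m *: A m - xy p + tau p *: A0 - (S p, 0),
     s p.1 - c p.2 * t + c0 * tau p + gf_ip (xy p) (zhat p.1) - lam * eps - rho p)].
  rewrite (eq_bigr (fun p => gf_ip (z p) (u p).1 + w p * (u p).2)); last first.
    by move=> p _; rewrite ffunE.
  apply: polar; exists s, t, lam, tau, xy, y; split=> //; first by rewrite /= lerDl.
  move=> p; have [tau0 y0 xyP rho0 SP] := pP p; rewrite ffunE.
  have sE : dual_slack (y p) (xy p) (tau p)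
      (\sum_m y p m *: A m - xy p + tau p *: A0 - (S p, 0)) = (S p, 0).
    by rewrite /dual_slack subKr.
  by split=> //; rewrite ?sE // /= gerBl.
have gf_ip0r x : gf_ip x (0 : GF) = 0 by rewrite gf_ipC gf_ip0l.
have quad0 v : 0 <= quad (0 : 'M[R]_K.+2) v v.
  by rewrite /quad mulmx0 mul0mx mxE.
pose P := [set x : (index_pair K -> R) * R * 'M[R]_K.+2 * R |
  [/\ forall m, 0 <= x.1.1.1 m, 0 <= x.1.1.2, forall v, 0 <= quad x.1.2 v v & 0 <= x.2]].
pose F p (x : (index_pair K -> R) * R * 'M[R]_K.+2 * R) :=
  gf_ip (z p) (\sum_m x.1.1.1 m *: A m + x.1.1.2 *: A0 - (x.1.2, 0))
  + w p * (c0 * x.1.1.2 - x.2).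
have sumZ0 : \sum_(m : index_pair K) (0 : R) *: A m = 0.
  by rewrite big1 // => m _; rewrite scale0r.
have local p x : P x -> F p x <= 0.
  apply: (@sum_le0_local _ _ _ P (fun=> 0, 0, 0, 0)) => //.
  - by move=> i; rewrite /F /= sumZ0 scale0r addr0 subr0 gf_ip0r mulr0 subr0 mulr0 addr0.
  - move=> h hP.
    have := @test (fun=> 0) 0 0 (fun p => (h p).1.1.2) (fun=> 0) (fun p => (h p).1.1.1)
      (fun p => (h p).1.2) (fun p => (h p).2) 0 (lexx 0) (lexx 0).
    rewrite [X in q * (_ * X + _)]big1 // mulr0 addr0 mulr0 addr0.
    under eq_bigr do rewrite subr0 gf_ip0l mulr0 mul0r !subr0 add0r addr0.
    apply=> l; have [y0 t0 S0 r0] := hP l; split=> //.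
    by split; [rewrite /sym_mx /= trmx0 | rewrite gf_norm0 lexx].
have zcone p : lifted_cone (z p) (w p).
  split.
  - apply: psd_self_dual => S S0.
    have := local p (fun=> 0, 0, S, 0); rewrite /F /= sumZ0 scale0r addr0 sub0r mulr0 subr0.
    rewrite mulr0 addr0 gf_ipC gf_ipNl oppr_le0 gf_ipC /gf_ip /= mulmx0 mxE addr0.
    by apply; split.
  - move=> m; have := local p (fun l => (l == m)%:R, 0, 0, 0).
    rewrite /F /= (bigD1 m) //= eqxx scale1r big1 => [|l /negbTE ->]; last by rewrite scale0r.
    rewrite scale0r !addr0 subr0 mulr0 subr0 mulr0 addr0 gf_ipC; apply; split=> //=.
  - have := local p (fun=> 0, 1, 0, 0).
    rewrite /F /= sumZ0 add0r scale1r subr0 mulr1 subr0 gf_ipC mulrC; apply; split=> //=.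
  - have := local p (fun=> 0, 0, 0, 1).
    rewrite /F /= sumZ0 add0r scale0r subr0 gf_ip0r mulr0 sub0r mulrN1 add0r oppr_le0.
    by apply; split => //=.
have global s t lam xy sigma : 0 <= lam -> 0 <= sigma ->
    (forall p, sym_mx (xy p).1 /\ gf_norm (xy p) <= lam) ->
    \sum_p (w p * (s p.1 - c p.2 * t - lam * eps) - gf_ip (xy p) (z p - w p *: zhat p.1))
    + q * (N%:R^-1 * \sum_i s i + sigma) <= 0.
  move=> lam0 sigma0 xyP.
  have tst := @test s t lam (fun=> 0) xy (fun _ _ => 0) (fun=> 0) (fun=> 0) sigma lam0 sigma0.
  apply: le_trans (tst _); last by move=> p; split=> //; exact: xyP.
  rewrite lerD2r; apply: ler_sum => p _.
  rewrite sumZ0 scale0r subr0 addr0 sub0r mulr0 addr0 subr0.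
  by rewrite !gf_ipBr gf_ipZr [gf_ip (z p) _]gf_ipC gf_ipNl; lra.
have N0 : N%:R != 0 :> R by rewrite pnatr_eq0 -lt0n.
have xy0 (lam : R) : 0 <= lam -> sym_mx (0 : GF).1 /\ gf_norm (0 : GF) <= lam.
  by move=> lam0; split; [rewrite /sym_mx /= trmx0 | rewrite gf_norm0].
have q0 : q <= 0.
  have := global (fun=> 0) 0 0 (fun=> 0) 1 (lexx 0) ler01 (fun=> xy0 _ (lexx 0)).
  rewrite big1 => [|p _]; first by rewrite big1 // mulr0 !add0r mulr1.
  by rewrite gf_ip0l mulr0 mul0r !subr0 mulr0.
have wsum i : \sum_j w (i, j) = - q / N%:R.
  apply/eqP; rewrite mulNr -addr_eq0; set a := fun i => \sum_j w (i, j) + q / N%:R.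
  suff : forall i x, setT x -> a i * x <= 0.
    (* each sum is tested against its own value, which makes its square nonpositive *)
    move=> /(_ i (a i) I); rewrite -expr2 => a2; rewrite -/(a i) -sqrf_eq0.
    by rewrite eq_le a2 sqr_ge0.
  apply: (@sum_le0_local _ _ _ setT 0) => // [l|h _]; first by rewrite mulr0.
  have := global h 0 0 (fun=> 0) 0 (lexx 0) (lexx 0) (fun=> xy0 _ (lexx 0)).
  congr (_ <= 0); rewrite addr0 mulrA.
  under eq_bigr do rewrite gf_ip0l mulr0 mul0r !subr0.
  rewrite sum_pair /= mulr_sumr -big_split /=.
  by apply: eq_bigr => l _; rewrite /a mulrDl mulr_suml.
split=> //.
- have tP t : - t * \sum_p w p * c p.2 <= 0.
    have := global (fun=> 0) t 0 (fun=> 0) 0 (lexx 0) (lexx 0) (fun=> xy0 _ (lexx 0)).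
    rewrite [X in q * (_ * X + _)]big1 // mulr0 addr0 mulr0 addr0 mulr_sumr.
    congr (_ <= 0); apply: eq_bigr => p _.
    by rewrite gf_ip0l mul0r !subr0 sub0r; ring.
  by have := tP 1; have := tP (-1); rewrite opprK mul1r mulN1r; lra.
- pose D p := z p - w p *: zhat p.1.
  have Ds p : sym_mx (D p).1.
    apply: sym_mxB; first by have [[]] := zcone p.
    by apply: sym_mxZ; have [[]] := zhat_lifted p.1.
  (* the normalized displacement attains the norm; where it vanishes, so does its
  inverse norm, and the multiplier is 0 *)
  have := global (fun=> 0) 0 1 (fun p => - (gf_norm (D p))^-1 *: D p) 0 ler01 (lexx 0).
  rewrite [X in q * (_ * X + _)]big1 // mulr0 addr0 mulr0 addr0.
  have -> : eps * - q = \sum_p w p * eps.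
    rewrite -mulr_suml sum_pair /=.
    under eq_bigr do rewrite wsum.
    by rewrite sumr_const card_ord -(mulr_natr (- q / N%:R)) divfK // mulrC.
  move=> tst; rewrite -subr_le0 -sumrB; apply: le_trans (tst _).
    apply: ler_sum => p _; rewrite gf_ipZl -/(D p) -gf_norm_sqr.
    suff : (gf_norm (D p))^-1 * gf_norm (D p) ^+ 2 = gf_norm (D p) by lra.
    have [->|n0] := eqVneq (gf_norm (D p)) 0; first by rewrite expr0n mulr0.
    by rewrite expr2 mulKf.
  move=> p; split; first exact: sym_mxZ.
  rewrite gf_normZ normrN ger0_norm ?invr_ge0 ?gf_norm_ge0 //.
  have [->|n0] := eqVneq (gf_norm (D p)) 0; first by rewrite mulr0 ler01.
  by rewrite mulVf.
Qed.

(** A theorem of the alternative without constraint qualification: a separating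
functional with [q = 0] is excluded by [lifted_cone0]. *)
Lemma dual_or_primal v :
  (exists s t lam tau xy y,
    dual_feasible eta mu L r zhat obj c eps s t lam tau xy y /\
    N%:R^-1 * \sum_i s i <= v) \/
  (exists z w, primal_feasible eta mu L r zhat c eps z w /\ v <= primal_objective obj z w).
Proof.
have [|Dv] := pselect (dual_cone ([ffun p => (obj p.2, 0)], v)).
  by move=> /dual_cone_feasible; left.
right; have [f [flin [e fe] fD fv]] := cone_separation dual_cone_convex Dv.
have [z [w [q fE]]] := family_riesz flin.
have [u k|zcone q0 wsum wc zdist] := @dual_cone_polar z w q.
  by rewrite -fE; exact: fD.
have qneg : q < 0.
  rewrite lt_neqAle q0 andbT; apply: contraNneq fe => q00.
  have w0 p : w p = 0.
    have w_ge0 l : 0 <= w l by have [] := zcone l.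
    case: p => i j; have := wsum i; rewrite q00 oppr0 mul0r => /eqP.
    by rewrite psumr_eq0 // => /allP/(_ j (mem_index_enum _))/eqP.
  have z0 p : z p = 0 by apply: lifted_cone0; rewrite -(w0 p).
  case: e fE => u k ->; rewrite q00 mul0r addr0 big1 // => p _.
  by rewrite z0 w0 gf_ip0l mul0r addr0.
have nq : 0 < - q by rewrite oppr_gt0.
pose om i j := w (i, j) / - q.
(* points of weight 0 are arbitrary points of the lifted set *)
pose zz i j := if w (i, j) == 0 then zhat i else (w (i, j))^-1 *: z (i, j).
have omz i j : om i j *: zz i j = (- q)^-1 *: z (i, j).
  rewrite /om /zz; case: eqP => [w0|/eqP w0].
    have := zcone (i, j); rewrite w0 => /lifted_cone0 ->.
    by rewrite mul0r scale0r scaler0.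
  by rewrite scalerA mulrAC mulfV // mul1r.
have om_ge0 i j : 0 <= om i j.
  by apply: divr_ge0; [have [] := zcone (i, j) | exact: ltW].
exists zz, om; split; first split.
- move=> i j; rewrite /zz; case: eqP => [_|/eqP w0]; first exact: zhat_lifted.
  apply: lifted_cone_pos (zcone _) _; rewrite lt0r w0.
  by have [] := zcone (i, j).
- split=> // [i|].
    by rewrite -mulr_suml wsum mulrAC divff ?lt0r_neq0 // mul1r.
  transitivity ((- q)^-1 * \sum_p w p * c p.2); last by rewrite wc mulr0.
  rewrite sum_pair /= [in RHS]exchange_big /= mulr_sumr; apply: eq_bigr => j _.
  by rewrite mulr_suml mulr_sumr; apply: eq_bigr => i _; rewrite /om; ring.
- rewrite -(ler_pM2r nq); apply: le_trans zdist.
  rewrite sum_pair /= mulr_suml.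
  apply: ler_sum => i _; rewrite mulr_suml; apply: ler_sum => j _.
  rewrite -[om i j]ger0_norm // -gf_normZ scalerBr omz.
  rewrite mulrC -{1}[- q]gtr0_norm // -gf_normZ scalerBr !scalerA /om.
  by rewrite mulfV ?lt0r_neq0 // scale1r mulrCA mulfV ?lt0r_neq0 // mulr1.
- move: fv; rewrite fE; under eq_bigr do rewrite ffunE /= mulr0 addr0.
  rewrite sum_pair /= => fv; rewrite -(ler_pM2l nq).
  rewrite (_ : - q * primal_objective obj zz om = \sum_i \sum_j gf_ip (z (i, j)) (obj j)); first by lra.
  rewrite mulr_sumr; apply: eq_bigr => i _; rewrite mulr_sumr; apply: eq_bigr => j _.
  by rewrite -gf_ipZr omz gf_ipZr mulrA mulfV ?lt0r_neq0 // mul1r gf_ipC.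
Qed.

Lemma dual_le_primal :
  (dual_value eta mu L r zhat obj c eps <= primal_value eta mu L r zhat obj c eps)%E.
Proof.
rewrite leNgt; apply/negP => pd.
have [v pv vd] : exists2 v : R, (primal_value eta mu L r zhat obj c eps < v%:E)%E &
    (v%:E < dual_value eta mu L r zhat obj c eps)%E.
  move: pd; case: (primal_value _ _ _ _ _ _ _ _) => [a| |] //;
    case: (dual_value _ _ _ _ _ _ _ _) => [b| |] //= ab.
  - by exists ((a + b) / 2); move: ab; rewrite !lte_fin; lra.
  - by exists (a + 1); rewrite ?ltry // lte_fin; lra.
  - by exists (b - 1); rewrite ?ltNyr // lte_fin; lra.
  - by exists 0; rewrite ?ltry ?ltNyr.
have [[s [t [lam [tau [xy [y [feas sv]]]]]]]|[z [w [feas vz]]]] := dual_or_primal v.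
  move: vd; rewrite ltNge => /negP; apply; apply: le_trans (_ : (N%:R^-1 * \sum_i s i)%:E <= _)%E.
    by apply: ereal_inf_lbound; exists s, t, lam, tau, xy, y.
  by rewrite lee_fin.
move: pv; rewrite ltNge => /negP; apply; apply: le_trans (_ : _ <= (primal_objective obj z w)%:E)%E _.
  by rewrite lee_fin.
by apply: ereal_sup_ubound; exists z, w.
Qed.

End ConicDuality.

(** * Measures with finite support, marginals, and Borel functions of pairs *)

Section FiniteSupport.
Context d (T : measurableType d) (R : realType) (I : finType).
Variables (w : I -> {nonneg R}) (x : I -> T) (x0 : T).
Local Open Scope ereal_scope.

Let mass (n : nat) : {measure set T -> \bar R} :=
  mscale (oapp (w \o enum_val) (0%:nng)%R (insub n : option 'I_#|I|))
         (dirac (oapp (x \o enum_val) x0 (insub n : option 'I_#|I|))).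

(** The measure with mass [w i] at [x i]. Finite sums of measures are indexed by
initial segments of the natural numbers, hence the detour through the enumeration
of [I]; the point [x0] only fills in the indices outside of it. *)
Definition atoms : set T -> \bar R := msum mass #|I|.

HB.instance Definition _ := Measure.on atoms.

Lemma atomsE A : atoms A = \sum_i (w i)%:num%:E * \d_(x i) A.
Proof.
rewrite /atoms /msum /=.
under eq_bigr do rewrite /mscale /= valK /=.
by rewrite [RHS](reindex _ (onW_bij _ (enum_val_bij I))).
Qed.

Lemma ge0_integral_atoms (f : T -> \bar R) : measurable_fun setT f ->
  (forall y, 0 <= f y) -> \int[atoms]_y f y = \sum_i (w i)%:num%:E * f (x i).
Proof.
move=> mf f0; rewrite ge0_integral_measure_sum //.
rewrite [RHS](reindex _ (onW_bij _ (enum_val_bij I))) /=.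
apply: eq_bigr => i _; rewrite ge0_integral_mscale // integral_dirac //.
by rewrite diracT mul1e valK.
Qed.

Lemma integral_atoms (f : T -> R) : measurable_fun setT f ->
  \int[atoms]_y (f y)%:E = (\sum_i (w i)%:num * f (x i))%:E.
Proof.
move=> mf; have mEf : measurable_fun setT (EFin \o f) by exact/measurable_EFinP.
rewrite integralE !ge0_integral_atoms //; last 2 first.
- exact: measurable_funeneg.
- exact: measurable_funepos.
have posE y : (EFin \o f)^\+ y = (Num.max (f y) 0)%:E by rewrite funeposE /= EFin_max.
have negE y : (EFin \o f)^\- y = (Num.max (- f y) 0)%:E by rewrite funenegE /= EFin_max.
under eq_bigr do rewrite posE -EFinM.
under [X in _ - X]eq_bigr do rewrite negE -EFinM.
rewrite !sumEFin -EFinB -sumrB; congr EFin.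
apply: eq_bigr => i _; rewrite -mulrBr; congr (_ * _)%R.
by case: (leP (f (x i)) 0%R) => ?; case: (leP (- f (x i))%R 0%R) => ?; lra.
Qed.

Lemma atoms_probability : (\sum_i (w i)%:num = 1)%R ->
  exists P : probability T R, [/\
    forall A, P A = \sum_i (w i)%:num%:E * \d_(x i) A,
    forall f : T -> R, measurable_fun setT f ->
      \int[P]_y (f y)%:E = (\sum_i (w i)%:num * f (x i))%:E &
    forall f : T -> \bar R, measurable_fun setT f -> (forall y, 0 <= f y) ->
      \int[P]_y f y = \sum_i (w i)%:num%:E * f (x i)].
Proof.
move=> w1; have P1 : atoms setT = 1.
  by rewrite atomsE; under eq_bigr do rewrite diracT mule1; rewrite sumEFin w1.
pose Pmix := Measure_isProbability.Build _ _ _ atoms P1.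
pose P : probability T R := HB.pack atoms Pmix.
exists P; split=> [A|f mf|f mf f0]; [exact: atomsE | exact: integral_atoms |].
exact: ge0_integral_atoms.
Qed.

End FiniteSupport.

Section BorelPairs.
Context {R : realType} {n k : nat}.
Let X := ('M[R]_n.+1 * 'cV[R]_k.+1)%type.

Lemma continuous_sum_fun (T : topologicalType) (I : Type) (s : seq I) (F : I -> T -> R) :
  (forall i, continuous (F i)) -> continuous (fun z => \sum_(i <- s) F i z).
Proof.
move=> cF; elim: s => [|i s IH] z.
  under eq_fun do rewrite big_nil; exact: cvg_cst.
by under eq_fun do rewrite big_cons; apply: cvgD; [exact: cF | exact: IH].
Qed.

Lemma continuous_entry1 i j : continuous (fun z : X => z.1 i j).
Proof.
by move=> z; apply: (@continuous_comp X _ _ fst (fun M : 'M[R]_n.+1 => M i j)); [exact: cvg_fst | exact: coord_continuous].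
Qed.

Lemma continuous_entry2 i : continuous (fun z : X => z.2 i 0).
Proof.
by move=> z; apply: (@continuous_comp X _ _ snd (fun M : 'cV[R]_k.+1 => M i 0)); [exact: cvg_snd | exact: coord_continuous].
Qed.

Lemma continuous_gf_ip (a : gf R n k) : continuous (fun z : X => gf_ip a z).
Proof.
under eq_fun do rewrite gf_ipE.
move=> z; apply: cvgD.
  apply: (@continuous_sum_fun X) => i; apply: continuous_sum_fun => j {}z.
  by apply: cvgM; [exact: cvg_cst | exact: continuous_entry1].
apply: (@continuous_sum_fun X) => i {}z.
by apply: cvgM; [exact: cvg_cst | exact: continuous_entry2].
Qed.

Lemma borel_measurable (f : X -> R) : continuous f ->
  measurable_fun setT (f : gf_borel R n k -> R).
Proof.
move=> /continuousP cf; apply: (measurability _ (RGenOpens.measurableE R)).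
move=> _ [_ [a [b ->] <-]]; rewrite setTI; apply: sub_sigma_algebra.
exact/cf/interval_open.
Qed.

Lemma measurable_gf_ip (a : gf R n k) :
  measurable_fun setT (fun z : gf_borel R n k => gf_ip a z).
Proof. by apply: borel_measurable; exact: continuous_gf_ip. Qed.

Lemma measurable_gf_dist d (T : measurableType d) (f g : T -> gf_borel R n k) :
  measurable_fun setT f -> measurable_fun setT g ->
  measurable_fun setT (fun t => gf_norm (f t - g t : gf R n k)).
Proof.
move=> mf mg.
have m1 (h : T -> gf_borel R n k) i j : measurable_fun setT h ->
    measurable_fun setT (fun t => (h t).1 i j : R).
  move=> mh; apply: (measurableT_comp (f := fun z : gf_borel R n k => z.1 i j)) => //.
  by apply: borel_measurable; exact: continuous_entry1.
have m2 (h : T -> gf_borel R n k) i : measurable_fun setT h ->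
    measurable_fun setT (fun t => (h t).2 i 0 : R).
  move=> mh; apply: (measurableT_comp (f := fun z : gf_borel R n k => z.2 i 0)) => //.
  by apply: borel_measurable; exact: continuous_entry2.
have d1 i j : measurable_fun setT (fun t => (f t - g t : gf R n k).1 i j : R).
  rewrite (_ : (fun t => _) = (fun t => (f t).1 i j - (g t).1 i j)).
    by apply: measurable_funB; exact: m1.
  by apply/funext => t; rewrite /= !mxE.
have d2 i : measurable_fun setT (fun t => (f t - g t : gf R n k).2 i 0 : R).
  rewrite (_ : (fun t => _) = (fun t => (f t).2 i 0 - (g t).2 i 0)).
    by apply: measurable_funB; exact: m2.
  by apply/funext => t; rewrite /= !mxE.
pose q t := \sum_i \sum_j (f t - g t : gf R n k).1 i j * (f t - g t : gf R n k).1 i j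
  + \sum_i (f t - g t : gf R n k).2 i 0 * (f t - g t : gf R n k).2 i 0.
have -> : (fun t => gf_norm (f t - g t : gf R n k)) = Num.sqrt \o q.
  by apply/funext => t; rewrite /= gf_normE gf_ipE.
apply: measurableT_comp.
  by apply: continuous_measurable_fun; exact: sqrt_continuous.
apply: measurable_funD.
  apply: measurable_sum => i; apply: measurable_sum => j.
  by apply: measurable_funM; exact: d1.
by apply: measurable_sum => i; apply: measurable_funM; exact: d2.
Qed.

Lemma closed_halfspace (a : gf R n k) (b : R) :
  closed ([set z | gf_ip a z <= b] : set X).
Proof.
have /continuous_closedP cip := @continuous_gf_ip a.
exact: cip _ (@closed_le R b).
Qed.

(** Self-duality writes the condition as an intersection of closed half-spaces. *)
Lemma closed_psd : closed ([set z | psd z.1] : set X).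
Proof.
have -> : [set z : X | psd z.1] = \bigcap_(S in [set S | forall v, 0 <= quad S v v])
    [set z : X | gf_ip ((- S, 0) : gf R n k) z <= 0].
  have ipE S (z : X) : gf_ip ((- S, 0) : gf R n k) z = - \tr (z.1^T *m S).
    rewrite gf_ipC /gf_ip /= mulmx0 mxE addr0 mulmxN.
    by rewrite linearN.
  apply/seteqP; split=> z.
    move=> zpsd S S0; rewrite /= ipE oppr_le0.
    by rewrite -mxtrace_tr trmx_mul trmxK psd_tr_ge0.
  move=> zS; apply: psd_self_dual => S S0.
  by have := zS S S0; rewrite /= ipE oppr_le0.
apply: closed_bigI => S _; exact: closed_halfspace.
Qed.

End BorelPairs.

Lemma measurable_lifted_set (R : realType) K eta (mu L r : R) :
  measurable (lifted_set eta mu L r : set (gf_borel R K.+1 K)).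
Proof.
suff cZ : closed (lifted_set eta mu L r : set ('M[R]_K.+2 * 'cV[R]_K.+1)%type).
  by rewrite -(setCK (lifted_set _ _ _ _)); apply: measurableC;
    apply: sub_sigma_algebra; rewrite openC.
have -> : (lifted_set eta mu L r : set ('M[R]_K.+2 * 'cV[R]_K.+1)%type) =
    [set z | psd z.1] `&` (\bigcap_(m in setT) [set z | gf_ip (interp_data eta mu L m) z <= 0])
    `&` [set z | gf_ip (init_data K) z <= - init_const r].
  apply/seteqP; split=> z.
    by move=> [zp zA zA0]; split; [split=> // m _; exact: zA|]; rewrite /= -subr_le0 opprK.
  move=> [[zp zA] zA0]; split=> // [m|]; first exact: zA.
  by move: zA0; rewrite /= -subr_le0 opprK.
apply: closedI; last exact: closed_halfspace.
apply: closedI; first exact: closed_psd.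
by apply: closed_bigI => m _; exact: closed_halfspace.
Qed.

Section Marginals.
Context d1 d2 (T1 : measurableType d1) (T2 : measurableType d2) (R : realType).
Variable g : {measure set (T1 * T2) -> \bar R}.
Local Open Scope ereal_scope.

Lemma ge0_integral_marginal1 (P : {measure set T1 -> \bar R}) (f : T1 -> \bar R) :
  (forall A, measurable A -> g (A `*` setT) = P A) ->
  measurable_fun setT f -> (forall x, 0 <= f x) ->
  \int[g]_z f z.1 = \int[P]_x f x.
Proof.
move=> gP mf f0.
rewrite -[LHS](ge0_integral_pushforward measurable_fst g measurableT mf (fun x _ => f0 x)).
apply: eq_measure_integral => A mA _; rewrite -gP // /pushforward.
by congr (g _); apply/seteqP; split=> [[a b]|[a b] []].
Qed.

Lemma ge0_integral_marginal2 (Q : {measure set T2 -> \bar R}) (f : T2 -> \bar R) :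
  (forall A, measurable A -> g (setT `*` A) = Q A) ->
  measurable_fun setT f -> (forall x, 0 <= f x) ->
  \int[g]_z f z.2 = \int[Q]_x f x.
Proof.
move=> gQ mf f0.
rewrite -[LHS](ge0_integral_pushforward measurable_snd g measurableT mf (fun x _ => f0 x)).
apply: eq_measure_integral => A mA _; rewrite -gQ // /pushforward.
by congr (g _); apply/seteqP; split=> [[a b]|[a b] []].
Qed.

End Marginals.

Section Loss.
Context {R : realType} {n k : nat}.
Variables (J : nat) (obj : 'I_J -> gf R n k) (c : 'I_J -> R) (t : R).
Local Open Scope ereal_scope.

Lemma loss_ge j z : (gf_ip (obj j) z + c j * t)%:E <= loss obj c t z.
Proof. by rewrite /loss; apply: (le_bigmax -oo (fun j => (gf_ip (obj j) z + c j * t)%:E)). Qed.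

Lemma loss_le z (B : R) : (forall j, gf_ip (obj j) z + c j * t <= B)%R ->
  loss obj c t z <= B%:E.
Proof.
move=> lB; apply: bigmax_le => [|j _]; first exact: leNye.
by rewrite lee_fin.
Qed.

Lemma loss_fin z : (0 < J)%N -> loss obj c t z \is a fin_num.
Proof.
move=> J0; rewrite fin_numElt; apply/andP; split.
  by apply: lt_le_trans (loss_ge (Ordinal J0) z); exact: ltNyr.
apply: le_lt_trans (ltry (\sum_j `|gf_ip (obj j) z + c j * t|)%R).
apply: loss_le => j; apply: le_trans (ler_norm _) _.
by rewrite (bigD1 j) //= lerDl sumr_ge0.
Qed.

Lemma measurable_loss : measurable_fun setT (fun z : gf_borel R n k => loss obj c t z).
Proof.
rewrite /loss; elim: (index_enum _) => [|j s IH].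
  under eq_fun do rewrite big_nil; exact: measurable_cst.
under eq_fun do rewrite big_cons; apply: measurable_maxe => //.
apply/measurable_EFinP; apply: measurable_funD; last exact: measurable_cst.
exact: measurable_gf_ip.
Qed.

End Loss.

(** * The worst-case expectation lies between the two problems *)

Section WeakDuality.
Context {R : realType}.
Variables (K : nat) (eta : nat -> nat -> R) (mu L r : R).
Variables (N J : nat) (zhat : 'I_N -> gf R K.+1 K).
Variables (obj : 'I_J -> gf R K.+1 K) (c : 'I_J -> R) (eps : R).

(** Pairing the slack matrix with [z] and dropping the nonpositive terms bounds
[gf_ip (obj j) z] by [- gf_ip (xy i j) z - init_const r * tau i j]; then [zhat i] is
subtracted from [z] in the pairing with [xy i j]. *)
Lemma dual_pointwise s t lam tau xy y z i j :
  dual_feasible eta mu L r zhat obj c eps s t lam tau xy y ->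
  lifted_set eta mu L r z ->
  gf_ip (obj j) z + c j * t <= s i + lam * gf_norm (z - zhat i) - lam * eps.
Proof.
move=> [lam0 /(_ i j) [[tau0 y0 xys] [sP Gpsd F0 xyl]]] [zpsd zA zA0].
pose T : gf R K.+1 K := \sum_m y i j m *: interp_data eta mu L m - xy i j
  + tau i j *: init_data K - obj j.
have TE : T = (\sum_m y i j m *: (interp_data eta mu L m).1 - (xy i j).1
             + tau i j *: (init_data K).1 - (obj j).1,
             \sum_m y i j m *: (interp_data eta mu L m).2 - (xy i j).2
             + tau i j *: (init_data K).2 - (obj j).2).
  rewrite /T; congr (_, _) => /=.
    by rewrite (big_morph fst (id1 := 0) (op1 := +%R)).
  by rewrite (big_morph snd (id1 := 0) (op1 := +%R)).
have : 0 <= gf_ip T z.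
  rewrite TE F0 /gf_ip /= trmx0 mul0mx [X in _ + X]mxE addr0.
  by apply: psd_tr_ge0 zpsd; case: Gpsd.
rewrite /T !(gf_ip_subl, gf_ipDl) gf_ip_suml gf_ipZl.
have : \sum_m gf_ip (y i j m *: interp_data eta mu L m) z <= 0.
  by apply: sumr_le0 => m _; rewrite gf_ipZl mulr_ge0_le0.
have : tau i j * (gf_ip (init_data K) z + init_const r) <= 0 by exact: mulr_ge0_le0.
rewrite mulrDr => hA0 hA hT.
have : gf_ip (xy i j) (zhat i - z) <= lam * gf_norm (z - zhat i).
  apply: le_trans (gf_cauchy_schwarz _ _) _; rewrite gf_normBC.
  by rewrite ler_wpM2r ?gf_norm_ge0 // -gf_dual_normE.
rewrite gf_ipBr; lra.
Qed.

End WeakDuality.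
Section WorstCaseLowerBound.
Context {R : realType}.
Variables (K : nat) (eta : nat -> nat -> R) (mu L r : R).
Variables (N J : nat) (zhat : 'I_N -> gf R K.+1 K).
Variables (obj : 'I_J -> gf R K.+1 K) (c : 'I_J -> R) (eps : R).
Hypotheses (N_gt0 : (0 < N)%N) (J_gt0 : (0 < J)%N).

Let X := gf_borel R K.+1 K.
Let Z := lifted_set (K := K) eta mu L r.
Let worst_case : \bar R :=
  ereal_sup [set ereal_inf [set (\int[Q]_z l z)%E | l in losses obj c]
            | Q in wasserstein_ball Z zhat eps].

Lemma empirical_atoms (w : 'I_N -> {nonneg R}) (x0 : X) A :
  (forall i, (w i)%:num = N%:R^-1) -> atoms w (zhat : 'I_N -> X) x0 A = empirical zhat A.
Proof.
move=> wE; rewrite atomsE /empirical ge0_sume_distrr; last by [].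
by apply: eq_bigr => i _; rewrite wE.
Qed.

(** The distribution of mass [w i j] at [z i j] is feasible, whatever the loss. *)
Lemma primal_le_worst_case :
  (primal_value eta mu L r zhat obj c eps <= worst_case)%E.
Proof.
apply: ge_ereal_sup => _ [z [w [[zZ [w0 wN wc] zdist] ->]]].
pose I := ('I_N * 'I_J)%type.
pose W (p : I) : {nonneg R} := NngNum (w0 p.1 p.2).
pose x (p : I) : X := z p.1 p.2.
pose xx (p : I) : X * X := (zhat p.1 : X, z p.1 p.2 : X).
have N0 : N%:R != 0 :> R by rewrite pnatr_eq0 -lt0n.
have W1 : \sum_p (W p)%:num = 1.
  rewrite sum_pair /=; under eq_bigr do rewrite wN.
  by rewrite sumr_const card_ord -(mulr_natr (N%:R^-1)) mulVf.
have [Q [QE Qint _]] := atoms_probability x (0 : X) W1.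
have [G [GE _ Gint]] := atoms_probability xx (0 : X * X)%type W1.
have Gcoupling : coupling (empirical zhat) Q G.
  move=> A mA; split.
    rewrite GE /empirical ge0_sume_distrr //.
    transitivity (\sum_i \sum_j (w i j)%:E * \d_(zhat i : X) A)%E.
      rewrite pair_big /=; apply: eq_bigr => p _; congr (_ * _)%E.
      rewrite !diracE; congr (_%:R%:E); congr nat_of_bool.
      by apply/idP/idP; rewrite !inE; [case|].
    apply: eq_bigr => i _; rewrite -ge0_sume_distrl ?sumEFin ?wN // => j _.
    by rewrite lee_fin.
  rewrite GE QE; apply: eq_bigr => p _; congr (_ * _)%E.
  rewrite !diracE; congr (_%:R%:E); congr nat_of_bool.
  by apply/idP/idP; rewrite !inE; [case|].
apply: (@le_trans _ _ (ereal_inf [set (\int[Q]_z l z)%E | l in losses obj c])).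
  apply: le_ereal_inf_tmp => _ [_ [t _ <-] <-].
  have lE y : loss obj c t y = (fine (loss obj c t y))%:E by rewrite fineK // loss_fin.
  under eq_integral do rewrite lE.
  rewrite Qint; last first.
    apply/measurable_EFinP; rewrite (_ : EFin \o _ = loss obj c t).
      exact: measurable_loss.
    by apply/funext => y; rewrite /= -lE.
  have -> : primal_objective obj z w =
      \sum_p (W p)%:num * (gf_ip (obj p.2) (x p) + c p.2 * t).
    under eq_bigr do rewrite mulrDr mulrA.
    rewrite big_split /= -mulr_suml !sum_pair /= [X in _ + X * t]exchange_big /=.
    under [X in _ + X * t]eq_bigr do rewrite -mulr_suml.
    by rewrite wc mul0r addr0.
  rewrite lee_fin; apply: ler_sum => p _; rewrite ler_wpM2l //.
  by rewrite -lee_fin -lE; exact: loss_ge.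
apply: ereal_sup_ubound; exists Q => //; split.
  rewrite QE (eq_bigr (fun p => (W p)%:num%:E)) => [|p _]; first by rewrite sumEFin W1.
  by rewrite diracE mem_set ?mule1 //; exact: zZ.
apply: (@le_trans _ _ (\int[G]_zw (gf_norm (zw.1 - zw.2 : gf R K.+1 K))%:E)%E).
  by apply: ereal_inf_lbound; exists G.
rewrite Gint; last 2 first.
- by apply/measurable_EFinP; apply: measurable_gf_dist.
- by move=> y; rewrite lee_fin gf_norm_ge0.
under eq_bigr do rewrite -EFinM gf_normBC.
by rewrite sumEFin lee_fin sum_pair.
Qed.

End WorstCaseLowerBound.

Section WorstCaseUpperBound.
Context {R : realType}.
Variables (K : nat) (eta : nat -> nat -> R) (mu L r : R).
Variables (N J : nat) (zhat : 'I_N -> gf R K.+1 K).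
Variables (obj : 'I_J -> gf R K.+1 K) (c : 'I_J -> R) (eps : R).
Hypotheses (mu_ge0 : 0 <= mu) (mu_lt_L : mu < L).
Hypotheses (N_gt0 : (0 < N)%N) (J_gt0 : (0 < J)%N).
Hypothesis eps_ge0 : 0 <= eps.

Let X := gf_borel R K.+1 K.
Let Z := lifted_set (K := K) eta mu L r.

(** Makes the loss integrable for every distribution in the ball. *)
Lemma loss_bounded t : exists2 C, 0 <= C & forall z, Z z -> `|fine (loss obj c t z)| <= C.
Proof.
have [B ZB] := lifted_set_bounded K eta r mu_ge0 mu_lt_L.
pose C := \sum_j (gf_norm (obj j) * `|B| + `|c j * t|).
have C0 : 0 <= C.
  by apply: sumr_ge0 => j _; rewrite addr_ge0 // mulr_ge0 // gf_norm_ge0.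
exists C => // z Zz.
have term j : `|gf_ip (obj j) z + c j * t| <= C.
  apply: (@le_trans _ _ (gf_norm (obj j) * `|B| + `|c j * t|)); last first.
    rewrite /C (bigD1 j) //= lerDl; apply: sumr_ge0 => l _.
    by rewrite addr_ge0 // mulr_ge0 // gf_norm_ge0.
  apply: le_trans (ler_normD _ _) _; rewrite lerD2r.
  have zB : gf_norm z <= `|B| by apply: le_trans (ZB z Zz) (ler_norm _).
  have oB : gf_norm (obj j) * gf_norm z <= gf_norm (obj j) * `|B|.
    by rewrite ler_wpM2l ?gf_norm_ge0.
  rewrite ler_norml; apply/andP; split; last first.
    by apply: le_trans (gf_cauchy_schwarz _ _) oB.
  rewrite lerNl -gf_ipNl; apply: le_trans (gf_cauchy_schwarz _ _) _.
  by rewrite gf_normN.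
have lE : loss obj c t z = (fine (loss obj c t z))%:E by rewrite fineK // loss_fin.
rewrite ler_norml; apply/andP; split; rewrite -lee_fin -lE.
  apply: le_trans (loss_ge _ _ _ (Ordinal J_gt0) z); rewrite lee_fin.
  by have := term (Ordinal J_gt0); rewrite ler_norml => /andP[].
by apply: loss_le => j; apply: le_trans (ler_norm _) (term j).
Qed.

(** The pointwise bound is integrated against a coupling of cost at most
[eps + e']. The loss is truncated to its range on the lifted set, and constants are
added, so that all integrands are nonnegative. *)
Lemma integral_loss_le (Q : probability X R) s t lam tau xy y :
  wasserstein_ball Z zhat eps Q ->
  dual_feasible eta mu L r zhat obj c eps s t lam tau xy y ->
  (\int[Q]_z loss obj c t z <= (N%:R^-1 * \sum_i s i)%:E)%E.
Proof.
move=> [QZ Wle] feas; have lam0 : 0 <= lam by case: feas.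
pose l z := fine (loss obj c t z).
have lE z : loss obj c t z = (l z)%:E by rewrite fineK // loss_fin.
have ml : measurable_fun setT (l : X -> R).
  apply/measurable_EFinP; rewrite (_ : EFin \o _ = loss obj c t).
    exact: measurable_loss.
  by apply/funext => z; rewrite /= -lE.
have [B B0 lB] := loss_bounded t.
pose C := B + \sum_i `|s i|.
have C0 : 0 <= C by rewrite addr_ge0 // sumr_ge0.
have lC z : Z z -> `|l z| <= C.
  by move=> /lB lzB; rewrite (le_trans lzB) // lerDl sumr_ge0.
have sC i : - C <= s i.
  rewrite lerNl /C (bigD1 i) //= addrCA -normrN (le_trans (ler_norm (- s i))) //.
  by rewrite lerDl addr_ge0 ?sumr_ge0.
(* truncated so as to be bounded off the lifted set, which has measure 0 *)
pose lc z := Num.max (- C) (Num.min (l z) C).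
have lcE z : Z z -> lc z = l z.
  move=> /lC; rewrite ler_norml => /andP[l1 l2].
  by rewrite /lc (min_idPl l2) (max_idPr l1).
have lcC z : - C <= lc z <= C.
  by rewrite /lc le_max lexx /= ge_max ge_min lexx orbT andbT ge0_cp.
have mlc : measurable_fun setT (lc : X -> R).
  apply: measurable_maxr; first exact: measurable_cst.
  by apply: measurable_minr => //; exact: measurable_cst.
have mZ : measurable (Z : set X) := measurable_lifted_set _ _ _ _.
have intl : (\int[Q]_z loss obj c t z = \int[Q]_z (lc z)%:E)%E.
  apply: ae_eq_integral => //.
  - exact: measurable_loss.
  - exact/measurable_EFinP.
  exists (~` Z); split; first exact: measurableC.
    by apply: etrans (probability_setC Q mZ) _; rewrite QZ subee.
  move=> z /= h; apply: contra_not h => Zz _.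
  by rewrite lE lcE.
have mlcE k : measurable_fun setT (fun z : X => (lc z + k)%:E).
  by apply/measurable_EFinP; apply: measurable_funD => //; exact: measurable_cst.
(* [S] depends on the first marginal only and bounds the loss up to the transport
cost; being a minimum over the samples, it also handles repeated samples *)
pose i0 : 'I_N := Ordinal N_gt0.
pose h i z := s i + lam * gf_norm (z - zhat i : gf R K.+1 K).
pose S z := \big[Num.min/h i0 z]_i h i z.
have SC z : - C <= S z.
  rewrite /S; elim/big_ind: _ => [|a b aC bC|i _].
  - by rewrite (le_trans (sC i0)) // lerDl mulr_ge0 ?gf_norm_ge0.
  - by rewrite le_min aC bC.
  - by rewrite (le_trans (sC i)) // lerDl mulr_ge0 ?gf_norm_ge0.
have Shat i : S (zhat i) <= s i.
  rewrite /S; apply: (@bigmin_inf _ R _ _ i) => //.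
  by rewrite /h subrr gf_norm0 mulr0 addr0.
have mS : measurable_fun setT (S : X -> R).
  have mh i : measurable_fun setT (h i : X -> R).
    apply: measurable_funD; first exact: measurable_cst.
    apply: measurable_funM; first exact: measurable_cst.
    by apply: measurable_gf_dist => //; exact: measurable_cst.
  rewrite /S; elim: (index_enum _) => [|i e IH].
    under eq_fun do rewrite big_nil; exact: mh.
  by under eq_fun do rewrite big_cons; apply: measurable_minr.
have key z1 z2 : Z z2 -> lc z2 + (C + lam * eps) <=
    S z1 + C + lam * gf_norm (z1 - z2 : gf R K.+1 K).
  move=> Zz2; rewrite lcE //.
  suff : l z2 + lam * eps - lam * gf_norm (z1 - z2 : gf R K.+1 K) <= S z1 by lra.
  have hi i : l z2 + lam * eps - lam * gf_norm (z1 - z2 : gf R K.+1 K) <= h i z1.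
    have : l z2 <= s i + lam * gf_norm (z2 - zhat i : gf R K.+1 K) - lam * eps.
      rewrite -lee_fin -lE; apply: loss_le => j.
      exact: dual_pointwise feas Zz2.
    have : lam * gf_norm (z2 - zhat i : gf R K.+1 K) <=
        lam * (gf_norm (z1 - z2 : gf R K.+1 K) + gf_norm (z1 - zhat i : gf R K.+1 K)).
      rewrite ler_wpM2l // -[X in gf_norm X <= _](subrKA z1) (gf_normBC z1).
      exact: gf_norm_triangle.
    by rewrite /h mulrDr; lra.
  by rewrite /S; elim/big_ind: _ => [|a b aC bC|i _]; rewrite ?le_min ?aC ?bC.
have empE : (\int[Q]_z (lc z + (C + lam * eps))%:E
    <= (N%:R^-1 * \sum_i s i + C + lam * eps)%:E)%E.
  apply/lee_addgt0Pr => e e0.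
  (* the excess cost [e'] is multiplied by [lam], which may be 0 *)
  pose e' := e / (lam + 1).
  have lam1 : 0 < lam + 1 by rewrite ltr_wpDl.
  have e'0 : 0 < e' by rewrite divr_gt0.
  have : (wasserstein (empirical zhat) Q < (eps + e')%:E)%E.
    by apply: le_lt_trans Wle _; rewrite lte_fin ltrDl.
  move=> /ereal_inf_lt[_ [g gE <-] gW].
  have g1 A (mA : measurable A) := (gE A mA).1.
  have g2 A (mA : measurable A) := (gE A mA).2.
  have N0 : 0 <= N%:R^-1 :> R by rewrite invr_ge0 ler0n.
  pose E := atoms (fun=> NngNum N0) (zhat : 'I_N -> X) 0.
  have g1E A : measurable A -> g (A `*` setT) = E A.
    by move=> mA; rewrite g1 // /E empirical_atoms.
  have kC : 0 <= C + lam * eps by rewrite addr_ge0 // mulr_ge0.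
  have lc0 z : 0 <= lc z + (C + lam * eps).
    by have /andP[+ _] := lcC z; have := mulr_ge0 lam0 eps_ge0; lra.
  rewrite -(ge0_integral_marginal2 g2 (mlcE _)); last by move=> z; rewrite lee_fin.
  have md : measurable_fun setT (fun zw : X * X => gf_norm (zw.1 - zw.2 : gf R K.+1 K)).
    exact: measurable_gf_dist.
  have mSC : measurable_fun setT (fun z : X => (S z + C)%:E).
    by apply/measurable_EFinP; apply: measurable_funD => //; exact: measurable_cst.
  have SC0 z : (0 <= (S z + C)%:E)%E by rewrite lee_fin -lerBlDr sub0r.
  have mSC1 : measurable_fun setT (fun zw : X * X => (S zw.1 + C)%:E).
    exact: (measurableT_comp mSC measurable_fst).
  have mld : measurable_fun setT (fun zw : X * X =>
      (lam%:E * (gf_norm (zw.1 - zw.2 : gf R K.+1 K))%:E)%E).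
    by under eq_fun do rewrite -EFinM; apply/measurable_EFinP; apply: measurable_funM.
  apply: (@le_trans _ _ (\int[g]_zw ((S zw.1 + C)%:E
      + lam%:E * (gf_norm (zw.1 - zw.2 : gf R K.+1 K))%:E))%E).
    apply: ae_ge0_le_integral => //.
    - by move=> z _; rewrite lee_fin.
    - exact: (measurableT_comp (mlcE _) measurable_snd).
    - move=> z _; apply: adde_ge0 => //.
      by rewrite -EFinM lee_fin mulr_ge0 ?gf_norm_ge0.
    - exact: emeasurable_funD.
    - exists (setT `*` ~` Z); split.
      + by apply: measurableX => //; exact: measurableC.
      + apply: etrans (g2 _ (measurableC mZ)) _.
        by apply: etrans (probability_setC Q mZ) _; rewrite QZ subee.
      + move=> [z1 z2] /= h'; split=> // Zz2; apply: h' => _.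
        by rewrite -EFinM -EFinD lee_fin; exact: key.
  rewrite ge0_integralD //; last first.
    by move=> z _; rewrite -EFinM lee_fin mulr_ge0 ?gf_norm_ge0.
  rewrite (ge0_integral_marginal1 g1E mSC SC0) ge0_integral_atoms //.
  rewrite ge0_integralZl_EFin //; last first.
  - exact/measurable_EFinP.
  - by move=> z _; rewrite lee_fin gf_norm_ge0.
  have -> : ((N%:R^-1 * \sum_i s i + C + lam * eps)%:E + e%:E =
      (N%:R^-1 * \sum_i s i + C)%:E + (lam * eps + e)%:E)%E.
    by rewrite -!EFinD; congr EFin; ring.
  apply: leeD.
    apply: (@le_trans _ _ (\sum_(i < N) (N%:R^-1 * (s i + C))%:E)%E).
      apply: lee_sum => i _; rewrite -EFinM lee_fin /= ler_wpM2l // lerD2r.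
      exact: Shat.
    rewrite sumEFin -mulr_sumr big_split /= mulrDr sumr_const card_ord.
    by rewrite -(mulr_natr C) mulrCA mulVf ?mulr1 // pnatr_eq0 -lt0n.
  apply: (@le_trans _ _ (lam%:E * (eps + e')%:E)%E).
    by apply: lee_wpmul2l; rewrite ?lee_fin // ltW.
  rewrite -EFinM lee_fin mulrDr lerD2l /e' mulrA ler_pdivrMr //.
  by have := ltW e0; lra.
have ilc : Q.-integrable setT (EFin \o (lc : X -> R)).
  apply: measurable_bounded_integrable => //.
    by have := ltry (1 : R); rewrite -(probability_setT Q).
  exists C; split; rewrite ?num_real // => M CM z _ /=.
  by apply: le_trans (ltW CM); rewrite ler_norml.
have icst : Q.-integrable setT (EFin \o (cst (C + lam * eps) : X -> R)).
  exact: finite_measure_integrable_cst.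
have : (\int[Q]_z (lc z + (C + lam * eps))%:E =
    \int[Q]_z (lc z)%:E + (C + lam * eps)%:E)%E.
  under eq_integral do rewrite EFinD.
  rewrite (integralD measurableT ilc icst); congr (_ + _)%E.
  apply: etrans (integral_cst Q measurableT (C + lam * eps)%:E) _.
  by apply: etrans (mule1 _); congr (_ * _)%E; exact: probability_setT.
rewrite intl => lcsum; move: empE; rewrite {}lcsum -(addrA (N%:R^-1 * _)) (EFinD (N%:R^-1 * _)).
by rewrite leeD2rE.
Qed.

Lemma worst_case_le_dual :
  (ereal_sup [set ereal_inf [set (\int[Q]_z l z)%E | l in losses obj c]
     | Q in wasserstein_ball Z zhat eps]
   <= dual_value eta mu L r zhat obj c eps)%E.
Proof.
apply: ge_ereal_sup => _ [Q ballQ <-].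
apply: le_ereal_inf_tmp => _ [s [t [lam [tau [xy [y [feas ->]]]]]]].
apply: le_trans (integral_loss_le ballQ feas).
by apply: ereal_inf_lbound; exists (loss obj c t) => //; exists t.
Qed.

End WorstCaseUpperBound.

Theorem theorem2 (R : realType) (mu L r : R) (K : nat) (eta : nat -> nat -> R)
    (N J : nat) (zhat : 'I_N -> gf R K.+1 K)
    (obj : 'I_J -> gf R K.+1 K) (c : 'I_J -> R) (eps : R)
    (hmu : 0 <= mu) (hmuL : mu < L) (hr : 0 < r) (hK : (1 <= K)%N)
    (heta : forall k, (k < K)%N -> eta k k != 0)
    (hN : (1 <= N)%N) (hJ : (1 <= J)%N)
    (hzhat : forall i, lifted_set eta mu L r (zhat i))
    (hobj : forall j, sym_mx (obj j).1)
    (heps : 0 < eps) :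
  let worst_case :=
    ereal_sup [set ereal_inf [set (\int[Q]_z l z)%E | l in losses obj c]
              | Q in wasserstein_ball (lifted_set eta mu L r) zhat eps] in
  worst_case = primal_value eta mu L r zhat obj c eps /\
  worst_case = dual_value eta mu L r zhat obj c eps.
Proof.
move=> worst_case.
have pw : (primal_value eta mu L r zhat obj c eps <= worst_case)%E.
  exact: primal_le_worst_case.
have wd : (worst_case <= dual_value eta mu L r zhat obj c eps)%E.
  by apply: worst_case_le_dual => //; exact: ltW.
have dp : (dual_value eta mu L r zhat obj c eps <=
    primal_value eta mu L r zhat obj c eps)%E.
  exact: dual_le_primal.
by split; apply/le_anti/andP; split=> //; [exact: le_trans wd dp | exact: le_trans dp pw].
Qed.
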